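(* Let $p>1$ and let $\varphi$ be an analytic self-map of $\mathbb{D}$ with $\varphi\in S^p$. Then $D_\varphi:S^p\to S^p$ is bounded if and only if $\|\varphi\|_\infty=\sup_{z\in\mathbb{D}}|\varphi(z)|<1$.
   Context: $\mathbb{D}$ is the open unit disk. For $p>1$, $H^p$ is the Hardy space on $\mathbb{D}$ with norm $\|g\|_{H^p}^p=\sup_{0<r<1}\int_0^{2\pi}|g(re^{i\theta})|^p\frac{d\theta}{2\pi}$; $S^p$ is the space of analytic $f$ on $\mathbb{D}$ with $f'\in H^p$, normed by $\|f\|_{S^p}=|f(0)|+\|f'\|_{H^p}$. The composition-differentiation operator is $D_\varphi f=f'\circ\varphi$. *)

(* Defs.v *)
From HB Require Import structures.
From mathcomp Require Import all_boot all_order all_algebra.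
From mathcomp Require Import all_classical all_reals all_analysis.
From mathcomp Require Import complex.
Set Implicit Arguments. Unset Strict Implicit. Unset Printing Implicit Defensive.
Import Order.TTheory GRing.Theory Num.Theory.
Import numFieldTopology.Exports numFieldNormedType.Exports.
Local Open Scope classical_set_scope.
Local Open Scope ring_scope.
Local Open Scope complex_scope.

Section Defs.
Variable R : realType.
Notation C := (R[i])^o.

Definition cabs (z : C) : R := Normc.normc z.

Definition disk : set C := [set z | cabs z < 1].

(* analytic (= holomorphic) on the disk: complex-differentiable at every point *)
Definition analytic_on_disk (f : C -> C) : Prop :=
  forall z, disk z -> derivable f z 1.

Definition cderiv (f : C -> C) : C -> C := fun z => 'D_1 f z.

Definition expi (t : R) : C := (cos t) +i* (sin t).

Definition integral_mean (p : R) (g : C -> C) (r : R) : \bar R :=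
  ((\int[lebesgue_measure]_(t in `[0%R, (2 * pi)%R]) ((cabs (g (r%:C * expi t))) `^ p)%:E)
    * ((2 * pi)^-1)%:E)%E.

Definition Hp_normp (p : R) (g : C -> C) : \bar R :=
  ereal_sup [set integral_mean p g r | r in `]0%R, 1%R[].

Definition in_Hp (p : R) (g : C -> C) : Prop :=
  analytic_on_disk g /\ (Hp_normp p g < +oo)%E.

(* ||g||_{H^p} (meaningful when g is in H^p) *)
Definition Hp_norm (p : R) (g : C -> C) : R := (fine (Hp_normp p g)) `^ (p^-1).

Definition in_Sp (p : R) (f : C -> C) : Prop :=
  analytic_on_disk f /\ in_Hp p (cderiv f).

Definition Sp_norm (p : R) (f : C -> C) : R := cabs (f 0) + Hp_norm p (cderiv f).

Definition Dcomp (phi : C -> C) (f : C -> C) : C -> C := cderiv f \o phi.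

Definition Dcomp_bounded_Sp (p : R) (phi : C -> C) : Prop :=
  (forall f, in_Sp p f -> in_Sp p (Dcomp phi f)) /\
  exists M : R, forall f, in_Sp p f -> Sp_norm p (Dcomp phi f) <= M * Sp_norm p f.

Definition self_map_disk (phi : C -> C) : Prop :=
  forall z, disk z -> disk (phi z).

Definition sup_norm_disk (phi : C -> C) : \bar R :=
  ereal_sup [set (cabs (phi z))%:E | z in disk].
End Defs.

(* Main.v *)
(* A twice complex differentiable function satisfies the maximum principle (add
   [e |z|^2] and compare the value at an interior maximum with the values at four
   nearby points).  Applied to powers of difference quotients it yields Cauchy
   estimates for [f'] and [f''], and these make the difference quotients of
   [f''] converge; no contour integral is needed.  On a circle, the inequality
   [w <= a + a^(1-p) w^p] bounds the oscillation of [f] by the [H^p] norm of [f'].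

   If [|phi| <= rho < 1], these facts bound [f'] and [f''] on the disk of radius
   [rho] by [||f'||_{H^p}], and (D_phi f)' = (f'' o phi) phi'.

   Conversely, testing the operator on z^(n+1)/(n+1) bounds [phi^n] in [S^p]
   uniformly in [n], so the functions [phi^n] are equicontinuous on circles.  If
   [|phi z|^n >= 1/2], then [|phi|^n >= 1/4] on a whole arc of fixed length
   2 pi/N through [z], and there [|phi'| <= (4/n) |(phi^n)'|], whence
   [|phi - phi z| <= 1/n] on that arc.  Rotating the arc around the circle, the
   maximum principle for the product of the 2N functions
   [phi (w_j x) - phi z] bounds [|phi 0 - phi z|^(2N)] by [4^N / n].  As [n]
   grows, [|phi z|] cannot be close to 1. *)
Require Import Defs.
From HB Require Import structures.
From mathcomp Require Import all_boot all_order all_algebra.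
From mathcomp Require Import all_classical all_reals all_analysis.
From mathcomp Require Import complex.
From mathcomp Require Import measurable_realfun.
From mathcomp Require Import ring lra.
Import Order.TTheory GRing.Theory Num.Theory.
Import numFieldTopology.Exports numFieldNormedType.Exports.

Set Implicit Arguments.
Unset Strict Implicit.
Unset Printing Implicit Defensive.
Local Open Scope ring_scope.

(** * Modulus, real part and the embedding of the reals *)

Section ComplexModulus.
Variable R : realType.
Local Notation C := (R[i])^o.
Implicit Types z w : C.

Definition cre (z : C) : R := complex.Re z.
(** The embedding [x%:C], restated with the codomain [(R[i])^o] on which derivatives are taken. *)
Definition ofR (x : R) : C := (x +i* 0)%C.

Lemma normc_cabs z : `|z| = ofR (cabs z).
Proof. by case: z => a b. Qed.

Lemma cabs_ge0 z : 0 <= cabs z.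
Proof. by case: z => a b; exact: sqrtr_ge0. Qed.

Lemma cabsM z w : cabs (z * w) = cabs z * cabs w.
Proof. exact: Normc.normcM. Qed.

Lemma cabsD z w : cabs (z + w) <= cabs z + cabs w.
Proof. exact: le_normcD. Qed.

Lemma cabsN z : cabs (- z) = cabs z.
Proof. exact: normcN. Qed.

Lemma cabs0 : cabs (0 : C) = 0.
Proof. exact: Normc.normc0. Qed.

Lemma cabs1 : cabs (1 : C) = 1.
Proof. exact: Normc.normc1. Qed.

Lemma cabsV z : cabs (z^-1) = (cabs z)^-1.
Proof. exact: Normc.normcV. Qed.

Lemma cabs_eq0 z : (cabs z == 0) = (z == 0).
Proof.
by apply/eqP/eqP => [/Normc.eq0_normc|->]; last exact: cabs0.
Qed.

Lemma cabs_gt0 z : (0 < cabs z) = (z != 0).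
Proof. by rewrite lt_def cabs_eq0 cabs_ge0 andbT. Qed.

Lemma cabsX z n : cabs (z ^+ n) = cabs z ^+ n.
Proof. by elim: n => [|n IH]; rewrite ?expr0 ?cabs1// !exprS cabsM IH. Qed.

Lemma cabs_ofR x : cabs (ofR x) = `|x|.
Proof. by rewrite /cabs /ofR /= expr0n /= addr0 sqrtr_sqr. Qed.

Lemma cabsC z w : cabs (z - w) = cabs (w - z).
Proof. by rewrite -cabsN opprB. Qed.

Lemma cabsB z w : cabs (z - w) <= cabs z + cabs w.
Proof. by rewrite -(cabsN w) cabsD. Qed.

Lemma cabs_leB z w : cabs z - cabs w <= cabs (z - w).
Proof. by have := cabsD (z - w) w; rewrite subrK; lra. Qed.

Lemma cabs_dist z w : `|cabs z - cabs w| <= cabs (z - w).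
Proof.
by have := cabs_leB z w; have := cabs_leB w z; rewrite (cabsC w z) ler_norml; lra.
Qed.

Lemma cabs_prod (I : Type) (s : seq I) (F : I -> C) :
  cabs (\prod_(i <- s) F i) = \prod_(i <- s) cabs (F i).
Proof. exact: (big_morph _ cabsM cabs1). Qed.

Lemma ofRM x y : ofR (x * y) = ofR x * ofR y.
Proof. exact: (rmorphM (real_complex R)). Qed.

Lemma ofRD x y : ofR (x + y) = ofR x + ofR y.
Proof. exact: (rmorphD (real_complex R)). Qed.

Lemma ofRB x y : ofR (x - y) = ofR x - ofR y.
Proof. exact: (rmorphB (real_complex R)). Qed.

Lemma ofR0 : ofR 0 = 0. Proof. by []. Qed.
Lemma ofR1 : ofR 1 = 1. Proof. by []. Qed.

Lemma ofR_nat n : ofR n%:R = n%:R.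
Proof. exact: (rmorph_nat (real_complex R)). Qed.

Lemma creD z w : cre (z + w) = cre z + cre w.
Proof. by case: z; case: w. Qed.

Lemma creN z : cre (- z) = - cre z.
Proof. by case: z. Qed.

Lemma creB z w : cre (z - w) = cre z - cre w.
Proof. by rewrite creD creN. Qed.

Lemma creZ x z : cre (ofR x * z) = x * cre z.
Proof. by case: z => a b; rewrite /cre /= mul0r subr0. Qed.

Lemma cre_ofR x : cre (ofR x) = x. Proof. by []. Qed.

Lemma cre_le z : `|cre z| <= cabs z.
Proof.
case: z => a b; rewrite /cabs /cre /= -sqrtr_sqr ler_wsqrtr//.
by rewrite lerDl sqr_ge0.
Qed.

Lemma cre_le_cabs z : cre z <= cabs z.
Proof. exact: le_trans (ler_norm _) (cre_le z). Qed.

(** Rotating by [k] turns a modulus into a real part, so that bounds on complex quantities follow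
    from theorems about real functions. *)
Lemma cabs_phase z : exists2 k : C, cabs k = 1 & k * z = ofR (cabs z).
Proof.
have [->|z0] := eqVneq z 0; first by exists 1; rewrite ?cabs1// mulr0 cabs0.
exists (ofR (cabs z) / z).
  by rewrite cabsM cabsV cabs_ofR ger0_norm ?cabs_ge0// divff// cabs_eq0.
by rewrite divfK.
Qed.

Lemma cabs_pair (x y : R) : cabs (x +i* y)%C <= `|x| + `|y|.
Proof.
have -> : (x +i* y)%C = ofR x + 'i%C * ofR y :> C.
  by rewrite /ofR; apply/eqP; rewrite eq_complex /=; apply/andP; split; apply/eqP; ring.
apply: le_trans (cabsD _ _) _; rewrite cabsM !cabs_ofR.
by rewrite /cabs /= expr0n/= add0r expr1n sqrtr1 mul1r.
Qed.

End ComplexModulus.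

(** * Complex differentiation *)

Section Derivatives.
Variable R : realType.
Local Notation C := (R[i])^o.
Implicit Types z w : C.

(* [i] embeds the increments into [C]: the identity for complex derivatives,
   [ofR] for derivatives of curves. *)
Definition has_der (V : zmodType) (i : V -> C) (f : V -> C) (x : V) (d : C) :=
  forall e : R, 0 < e -> exists2 k : R, 0 < k &
    forall h, cabs (i h) < k ->
      cabs (f (x + h) - f x - i h * d) <= e * cabs (i h).

Notation cder := (@has_der C id).
Notation rder := (@has_der R (@ofR R)).

Lemma has_der_lip V i f x d : @has_der V i f x d ->
  exists2 k : R, 0 < k & forall h, cabs (i h) < k ->
    cabs (f (x + h) - f x) <= (cabs d + 1) * cabs (i h).
Proof.
move=> /(_ 1 ltr01) [k k0 H]; exists k => // h /H.
have := cabsD (f (x + h) - f x - i h * d) (i h * d).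
rewrite subrK cabsM; lra.
Qed.

Lemma has_der_comp V i f x d g d' : @has_der V i f x d -> cder g (f x) d' ->
  @has_der V i (g \o f) x (d * d').
Proof.
move=> hf hg e e0.
have D0 := cabs_ge0 d; have D0' := cabs_ge0 d'.
(* The error of [g] is measured against an increment of [f] of size at most
   [(cabs d + 1) * cabs (i h)], that of [f] is multiplied by [d']. These choices make each
   contribution at most [e / 2 * cabs (i h)]. *)
have e1 : 0 < e / (2 * (cabs d + 1)) by rewrite divr_gt0//; lra.
have e2 : 0 < e / (2 * (cabs d' + 1)) by rewrite divr_gt0//; lra.
have [k1 k10 H1] := hg _ e1.
have [k2 k20 H2] := has_der_lip hf.
have [k3 k30 H3] := hf _ e2.
have k4 : 0 < k1 / (cabs d + 1) by rewrite divr_gt0//; lra.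
exists (Num.min k2 (Num.min k3 (k1 / (cabs d + 1)))).
  by rewrite !lt_min k20 k30 k4.
move=> h; rewrite !lt_min => /and3P[hk2 hk3 hk1].
have I0 := cabs_ge0 (i h).
have {}hk1 : (cabs d + 1) * cabs (i h) < k1.
  by move: hk1; rewrite ltr_pdivlMr ?(mulrC (cabs d + 1))//; lra.
have L := H2 _ hk2; have := H1 _ (le_lt_trans L hk1); have := H3 _ hk3.
set Df := f (x + h) - f x in L * => A B.
have E : (g \o f) (x + h) - (g \o f) x - i h * (d * d') =
  (g (f x + Df) - g (f x) - Df * d') + (Df - i h * d) * d'.
  have fxh : f (x + h) = f x + Df by rewrite /Df; ring.
  by rewrite /= fxh; ring.
rewrite E; apply: le_trans (cabsD _ _) _.
have B' : cabs (g (f x + Df) - g (f x) - Df * d') <= e / 2 * cabs (i h).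
  apply: le_trans B _.
  have -> : e / 2 * cabs (i h) = e / (2 * (cabs d + 1)) * ((cabs d + 1) * cabs (i h)).
    by field; apply/eqP; lra.
  by rewrite ler_wpM2l// ltW.
have A' : cabs ((Df - i h * d) * d') <= e / 2 * cabs (i h).
  rewrite cabsM.
  have -> : e / 2 * cabs (i h) = e / (2 * (cabs d' + 1)) * cabs (i h) * (cabs d' + 1).
    by field; apply/eqP; lra.
  by apply: ler_pM => //; [exact: cabs_ge0|lra].
lra.
Qed.

Lemma has_der_ext V i f g x d : f =1 g -> @has_der V i f x d -> @has_der V i g x d.
Proof. by move=> fg H e /H[k k0 K]; exists k => // h /K; rewrite !fg. Qed.

(** Multiplying the error of the difference quotient by the modulus of [h] removes the division; the
    increment [h = 0], absent from the filter, is then harmless. A general [K] covers both [R] and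
    [R[i]]. *)
Lemma is_derive_numfieldP (K : numFieldType) (f : K^o -> K^o) (z d : K^o) :
  is_derive z 1 f d <->
  forall e : K, 0 < e -> exists2 k : K, 0 < k &
    forall h : K, `|h| < k -> `|f (z + h) - f z - h * d| <= e * `|h|.
Proof.
have key (h : K) : h != 0 -> forall e : K,
    (`|d - h^-1 *: ((f \o shift z) (h *: (1 : K^o)) - f z)| <= e) =
    (`|f (z + h) - f z - h * d| <= e * `|h|).
  move=> h0 e.
  have -> : d - h^-1 *: ((f \o shift z) (h *: (1 : K^o)) - f z) =
      - (h^-1 * (f (z + h) - f z - h * d)).
    by rewrite /= [h *: _]mulr1 (addrC h) [in RHS]mulrBr mulKf// opprB.
  by rewrite normrN normrM normfV ler_pdivrMl ?normr_gt0// (mulrC e).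
split=> [[cv dE] e e0|H].
  have : (h^-1 *: ((f \o shift z) (h *: (1 : K^o)) - f z)
    @[h --> (0 : K)^'] --> d)%classic by rewrite -dE; exact: cv.
  move=> /cvgrPdist_le/(_ _ e0)[k k0 B]; exists k => // h hk.
  have [->|h0] := eqVneq h 0.
    by rewrite addr0 subrr mul0r subr0 normr0 mulr0.
  by rewrite -key//; apply: B => //=; rewrite sub0r normrN.
have cv : (h^-1 *: ((f \o shift z) (h *: (1 : K^o)) - f z)
    @[h --> (0 : K)^'] --> d)%classic.
  apply/cvgrPdist_le => e e0; have [k k0 B] := H e e0.
  exists k => // h /=; rewrite sub0r normrN => hk h0.
  by rewrite -/((f \o shift z) _) key// B.
by apply: DeriveDef; [apply/cvg_ex; exists d|apply: cvg_lim].
Qed.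

Lemma cder_is_derive f z d : cder f z d -> is_derive z 1 f d.
Proof.
move=> H; apply/(@is_derive_numfieldP R[i]) => -[e e'].
(* A positive element of [R[i]] has imaginary part 0, so complex tolerances reduce to positive
   reals. *)
rewrite ltcE /= => /andP[/eqP-> e0].
have [k k0 B] := H e e0; exists (ofR k); first by rewrite ltcE /= eqxx.
move=> h; rewrite [`|h|]normc_cabs ltcE /= eqxx /= => /B.
by rewrite [`|_ - _|]normc_cabs -[(e +i* 0)%C]/(ofR e) -ofRM lecE /= eqxx.
Qed.

Lemma cderP f z d : is_derive z 1 f d -> cder f z d.
Proof.
move=> /(@is_derive_numfieldP R[i]) H e e0.
have [|[k k'] ] := H (ofR e); first by rewrite ltcE /= eqxx.
rewrite ltcE /= => /andP[/eqP-> k0] B; exists k => // h hk.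
have := B h; rewrite [`|h|]normc_cabs ltcE /= eqxx => /(_ hk).
by rewrite [`|_ - _|]normc_cabs -ofRM lecE /= eqxx.
Qed.

Lemma derivable_cder f z : derivable f z 1 -> cder f z (cderiv f z).
Proof. by move=> /derivableP/cderP. Qed.

Lemma cder_derivable f z d : cder f z d -> derivable f z 1.
Proof. by case/cder_is_derive. Qed.

Lemma cder_cderiv f z d : cder f z d -> cderiv f z = d.
Proof. by case/cder_is_derive. Qed.

Lemma has_der_eqd V i f x d d' : @has_der V i f x d -> d = d' -> @has_der V i f x d'.
Proof. by move=> ? <-. Qed.

Lemma has_der_cst V i (k : C) x : @has_der V i (fun=> k) x 0.
Proof.
move=> e e0; exists 1 => // h _; rewrite subrr mulr0 subr0 cabs0.
by rewrite mulr_ge0 ?cabs_ge0// ltW.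
Qed.

Lemma has_derD V i f g x d d' : @has_der V i f x d -> @has_der V i g x d' ->
  @has_der V i (fun t => f t + g t) x (d + d').
Proof.
move=> hf hg e e0; have e2 : 0 < e / 2 by lra.
have [k1 k10 H1] := hf _ e2; have [k2 k20 H2] := hg _ e2.
exists (Num.min k1 k2); first by rewrite lt_min k10 k20.
move=> h; rewrite lt_min => /andP[/H1 A /H2 B].
have -> : f (x + h) + g (x + h) - (f x + g x) - i h * (d + d') =
  (f (x + h) - f x - i h * d) + (g (x + h) - g x - i h * d') by ring.
by apply: le_trans (cabsD _ _) _; lra.
Qed.

Lemma has_derZ V i f x d (k : C) : @has_der V i f x d ->
  @has_der V i (fun t => k * f t) x (k * d).
Proof.
move=> H e e0.
have K0 := cabs_ge0 k.
have e1 : 0 < e / (cabs k + 1) by rewrite divr_gt0//; lra.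
have [l l0 L] := H _ e1; exists l => // h /L hl.
have -> : k * f (x + h) - k * f x - i h * (k * d) =
  k * (f (x + h) - f x - i h * d) by ring.
rewrite cabsM; apply: (@le_trans _ _ (cabs k * (e / (cabs k + 1) * cabs (i h)))).
  by rewrite ler_wpM2l.
rewrite mulrA ler_wpM2r ?cabs_ge0// mulrCA ger_pMr//.
by rewrite ler_pdivrMr ?mul1r; lra.
Qed.

Lemma has_derB V i f g x d d' : @has_der V i f x d -> @has_der V i g x d' ->
  @has_der V i (fun t => f t - g t) x (d - d').
Proof.
move=> hf /(has_derZ (-1)) hg; apply: has_der_ext (has_der_eqd (has_derD hf hg) _).
  by move=> t /=; rewrite mulN1r.
by rewrite mulN1r.
Qed.

Lemma cder_id z : cder id z 1.
Proof.
move=> e e0; exists 1 => // h _; have -> : z + h - z - h * 1 = 0 by ring.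
rewrite cabs0.
by rewrite mulr_ge0 ?cabs_ge0// ltW.
Qed.

Lemma rder_ofR t : rder (@ofR R) t 1.
Proof.
move=> e e0; exists 1 => // h _.
rewrite ofRD; have -> : ofR t + ofR h - ofR t - ofR h * 1 = 0 by ring.
rewrite cabs0.
by rewrite mulr_ge0 ?cabs_ge0// ltW.
Qed.

Lemma cderM f g z d d' : cder f z d -> cder g z d' ->
  cder (fun x => f x * g x) z (d * g z + f z * d').
Proof.
move=> /cder_is_derive hf /cder_is_derive hg; apply: cderP.
apply: (is_derive_eq (is_deriveM hf hg)).
by rewrite addrC mulrC.
Qed.

Lemma cderX f z d n : cder f z d ->
  cder (fun x => f x ^+ n) z (n%:R * f z ^+ n.-1 * d).
Proof.
move=> hf; elim: n => [|n IH].
  by rewrite mul0r mul0r; exact: has_der_cst.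
apply: has_der_ext (has_der_eqd (cderM hf IH) _).
  by move=> x; rewrite exprS.
case: n {IH} => [|n] /=; first by rewrite !mul0r mulr0 addr0 !expr0; ring.
by rewrite !exprS -[n.+2]addn1 natrD; ring.
Qed.

Lemma cderV z : z != 0 -> cder (fun x => x^-1) z (- z ^- 2).
Proof.
move=> z0 e e0.
have Z0 : 0 < cabs z by rewrite cabs_gt0.
(* The remainder is [h ^+ 2 / (z ^+ 2 * (z + h))], and [cabs h < cabs z / 2] keeps [cabs (z + h)]
   above [cabs z / 2]; this gives the radius. *)
have q0 : 0 < e * cabs z ^+ 3 / 2 by rewrite divr_gt0// mulr_gt0// exprn_gt0.
exists (Num.min (cabs z / 2) (e * cabs z ^+ 3 / 2)).
  by rewrite lt_min q0; lra.
move=> h; rewrite lt_min => /andP[h1 h2].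
have zh : cabs z / 2 < cabs (z + h).
  by have := cabs_leB z (- h); rewrite opprK cabsN; lra.
have zh0 : z + h != 0 by rewrite -cabs_gt0; lra.
have -> : (z + h)^-1 - z^-1 - h * - z ^- 2 = h * h * (z ^- 2 * (z + h)^-1).
  by field; rewrite zh0 z0.
rewrite !cabsM cabsV cabsX cabsV.
have -> : cabs h * cabs h * ((cabs z ^+ 2)^-1 * (cabs (z + h))^-1) =
   cabs h / (cabs z ^+ 2 * cabs (z + h)) * cabs h.
  by field; rewrite !cabs_eq0 zh0 z0.
rewrite ler_wpM2r ?cabs_ge0// ler_pdivrMr ?mulr_gt0 ?exprn_gt0//; last lra.
apply: le_trans (ltW h2) _.
have -> : e * cabs z ^+ 3 / 2 = e * (cabs z ^+ 2 * (cabs z / 2)).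
  by field.
by rewrite ler_wpM2l ?(ltW e0)// ler_wpM2l ?exprn_ge0 ?cabs_ge0// ltW.
Qed.

Lemma rder_curve t (a b : C) : rder (fun s => a + ofR s * b) t b.
Proof.
have h1 := has_derZ b (rder_ofR t).
have h2 := has_derD (has_der_cst (@ofR R) a t) h1.
by apply: has_der_ext (has_der_eqd h2 _) => [s|] /=; rewrite ?mulr1 ?add0r // mulrC.
Qed.

Lemma rder_cre f t d : rder f t d -> is_derive t 1 (fun s => cre (f s)) (cre d).
Proof.
move=> H.
have cv : (h^-1 *: (((fun s => cre (f s)) \o shift t) (h *: (1 : R)) - cre (f t))
    @[h --> (0 : R)^'] --> cre d)%classic.
  apply/cvgrPdist_le => e e0; have [k k0 K] := H e e0.
  exists k => // h /=; rewrite sub0r normrN => hk h0.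
  have := K h; rewrite cabs_ofR => /(_ hk) B.
  rewrite distrC [h%:A]mulr1 (addrC h).
  have -> : h^-1 *: (cre (f (t + h)) - cre (f t)) - cre d =
      h^-1 * cre (f (t + h) - f t - ofR h * d).
    by rewrite !creB creZ [in RHS]mulrBr mulKf.
  rewrite normrM normfV -(ler_pM2l (x:=`|h|)) ?normr_gt0//.
  rewrite mulVKf ?normr_eq0// (mulrC _ e); exact: le_trans (cre_le _) B.
by apply: DeriveDef; [apply/cvg_ex; exists (cre d)|apply: cvg_lim].
Qed.

Lemma rder_continuous_cabs f t d : rder f t d ->
  {for t, continuous (fun s => cabs (f s))}.
Proof.
move=> /has_der_lip[k k0 K]; apply/cvgrPdist_le => e e0.
have D0 := cabs_ge0 d.
have q0 : 0 < e / (cabs d + 1) by rewrite divr_gt0//; lra.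
exists (Num.min k (e / (cabs d + 1))); first by rewrite /= lt_min k0 q0.
move=> s /=; rewrite lt_min => /andP[h1 h2].
have := K (s - t); rewrite cabs_ofR distrC => /(_ h1).
have -> : t + (s - t) = s by ring.
move=> A.
rewrite distrC; apply: le_trans (cabs_dist _ _) _; apply: le_trans A _.
by rewrite mulrC -ler_pdivlMr ?(ltW h2)//; lra.
Qed.

End Derivatives.
Notation cder := (@has_der _ _ id).
Notation rder := (@has_der _ _ (@ofR _)).

(** * Mean value inequalities, four-point sums and extrema on closed disks *)

Section MeanValue.
Variable R : realType.
Local Notation C := (R[i])^o.

Lemma is_derive_continuous (f : R -> R) (t d : R) : is_derive t 1 f d ->
  {for t, continuous f}.
Proof. by case=> df _; apply/differentiable_continuous/derivable1_diffP. Qed.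

Lemma real_mean_value (f df : R -> R) (a b : R) : a <= b ->
  (forall x, a <= x <= b -> is_derive x 1 f (df x)) ->
  exists2 x, a <= x <= b & f b - f a = df x * (b - a).
Proof.
move=> ab H; have [||x xab E] := MVT_segment (f:=f) (df:=df) ab.
- by move=> x; rewrite in_itv /= => /andP[ax xb]; apply: H; rewrite !ltW.
- apply: derivable_within_continuous => x; rewrite in_itv /= => /H.
  by case.
- by exists x => //; rewrite in_itv in xab.
Qed.

(** The real mean value theorem is applied to [cre (k * F s)], where the unimodular [k] makes
    [k * (F b - F a)] real and nonnegative. *)
Lemma curve_mean_value (F dF : R -> C) (B a b : R) : a <= b ->
  (forall s, a <= s <= b -> rder F s (dF s)) ->
  (forall s, a <= s <= b -> cabs (dF s) <= B) ->
  cabs (F b - F a) <= B * (b - a).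
Proof.
move=> ab HF HB; have [k k1 kE] := cabs_phase (F b - F a).
have [|s sab E] := real_mean_value (f:=fun s => cre (k * F s))
    (df:=fun s => cre (k * dF s)) ab.
  by move=> s /HF h; apply: rder_cre; exact: has_derZ.
have -> : cabs (F b - F a) = cre (k * F b) - cre (k * F a).
  by rewrite -creB -mulrBr kE cre_ofR.
rewrite E ler_wpM2r ?subr_ge0//; apply: le_trans (cre_le_cabs _) _.
by rewrite cabsM k1 mul1r; exact: HB.
Qed.

Lemma segment_mean_value (f f' : C -> C) (B : R) (z w : C) :
  (forall s : R, 0 <= s <= 1 ->
     cder f (z + ofR s * (w - z)) (f' (z + ofR s * (w - z))) /\
     cabs (f' (z + ofR s * (w - z))) <= B) ->
  cabs (f w - f z) <= B * cabs (w - z).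
Proof.
move=> H.
have := @curve_mean_value (fun s => f (z + ofR s * (w - z)))
  (fun s => (w - z) * f' (z + ofR s * (w - z))) (B * cabs (w - z)) 0 1 ler01.
rewrite ofR1 ofR0 mul1r mul0r addr0 subr0 mulr1 (addrC z) subrK; apply.
- by move=> s /H[h _]; exact: has_der_comp (rder_curve s z (w - z)) h.
- by move=> s /H[_ h]; rewrite cabsM mulrC ler_wpM2r ?cabs_ge0.
Qed.

(* The sums of [b] and of [b^2] over the directions [1, -1, i, -i] vanish, so the
   Taylor terms of order one and two of [G] at [z] cancel. *)
Lemma four_point_littleo (G G1 : C -> C) (z d2 : C) (k : R) : 0 < k ->
  (forall h, cabs h < k -> cder G (z + h) (G1 (z + h))) -> cder G1 z d2 ->
  forall e : R, 0 < e -> exists2 l : R, 0 < l & forall x : R, 0 < x -> x < l ->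
    cabs (G (z + ofR x) + G (z - ofR x) + G (z + ofR x * 'i%C)
      + G (z - ofR x * 'i%C) - 4 * G z) <= e * x ^+ 2.
Proof.
move=> k0 HG HG1 e e0.
have e4 : 0 < e / 4 by lra.
have [l l0 L] := HG1 _ e4.
exists (Num.min k l); first by rewrite lt_min k0 l0.
move=> x x0; rewrite lt_min => /andP[xk xl].
have iE : cabs ('i%C : C) = 1 by rewrite /cabs /= expr0n/= add0r expr1n sqrtr1.
pose term (b : C) (s : R) := G (z + ofR s * b).
pose S (s : R) := term 1 s + term (-1) s + term 'i%C s + term (- 'i%C) s.
pose dS (s : R) := 1 * G1 (z + ofR s * 1) + (-1) * G1 (z + ofR s * (-1)) +
  'i%C * G1 (z + ofR s * 'i%C) + (- 'i%C) * G1 (z + ofR s * (- 'i%C)) : C.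
have Hs (b : C) (s : R) : cabs b = 1 -> 0 <= s <= x -> cabs (ofR s * b) = s.
  by move=> b1 /andP[s0 _]; rewrite cabsM b1 mulr1 cabs_ofR ger0_norm.
have Ht (b : C) (s : R) : cabs b = 1 -> 0 <= s <= x ->
    rder (term b) s (b * G1 (z + ofR s * b)).
  move=> b1 sx; apply: (has_der_comp (g:=G) (f:=fun s => z + ofR s * b)).
    exact: rder_curve.
  by apply: HG; rewrite Hs//; case/andP: sx => _; lra.
have HN (b : C) : cabs b = 1 -> cabs (- b) = 1 by rewrite cabsN.
have := @curve_mean_value S dS (e * x) 0 x (ltW x0).
have -> : S x - S 0 = G (z + ofR x) + G (z - ofR x) + G (z + ofR x * 'i%C)
      + G (z - ofR x * 'i%C) - 4 * G z.
  rewrite /S /term ofR0 !mul0r addr0 mulr1 mulrN1 mulrN; ring.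
rewrite subr0 -mulrA -expr2; apply.
- move=> s sx; rewrite /S /dS.
  apply: has_derD; [apply: has_derD; [apply: has_derD|]|]; apply: Ht;
    by rewrite ?HN ?cabs1 ?iE.
- move=> s sx.
  pose T (b : C) := b * (G1 (z + ofR s * b) - G1 z - ofR s * b * d2).
  have TE (b : C) : cabs b = 1 -> cabs (T b) <= e / 4 * x.
    move=> b1; rewrite /T cabsM b1 mul1r; apply: le_trans (L _ _) _.
      by rewrite Hs//; case/andP: sx => _; lra.
    by rewrite Hs// ler_wpM2l ?(ltW e4)//; case/andP: sx.
  have -> : dS s = T 1 + T (-1) + T 'i%C + T (- 'i%C).
    have i2 : ('i%C : C) * 'i%C = -1 by exact: sqr_i.
    rewrite /T /dS !mulrBr.
    have -> : - 'i%C * (ofR s * - 'i%C * d2) = ('i%C * 'i%C) * (ofR s * d2) by ring.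
    have -> : 'i%C * (ofR s * 'i%C * d2) = ('i%C * 'i%C) * (ofR s * d2) by ring.
    by rewrite i2; ring.
  have a1 := TE 1 (cabs1 _); have a2 := TE (-1) (HN _ (cabs1 _)).
  have a3 := TE 'i%C iE; have a4 := TE (- 'i%C) (HN _ iE).
  apply: le_trans (cabsD _ _) _; apply: le_trans (lerD (cabsD _ _) (lexx _)) _.
  apply: le_trans (lerD (lerD (cabsD _ _) (lexx _)) (lexx _)) _; lra.
Qed.

Definition ccontinuous (G : C -> C) (z : C) := forall e : R, 0 < e ->
  exists2 k : R, 0 < k & forall h, cabs h < k -> cabs (G (z + h) - G z) < e.

Lemma cder_ccontinuous G z d : cder G z d -> ccontinuous G z.
Proof.
move=> /has_der_lip[k k0 K] e e0; have D0 := cabs_ge0 d.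
have q0 : 0 < e / (cabs d + 1) by rewrite divr_gt0//; lra.
exists (Num.min k (e / (cabs d + 1))); first by rewrite lt_min k0 q0.
move=> h; rewrite lt_min => /andP[/K A]; rewrite ltr_pdivlMr; last lra.
by rewrite mulrC; exact: le_lt_trans.
Qed.

(** The disk is transported by [P] to a closed subset of a square in [R * R], whose compactness
    comes from that of segments; the extreme value theorem applies there. *)
Lemma disk_max (v : C -> R) (c : C) (r : R) : 0 <= r ->
  (forall z, cabs (z - c) <= r -> forall e : R, 0 < e -> exists2 k : R, 0 < k &
     forall h, cabs h < k -> `|v (z + h) - v z| < e) ->
  exists2 z, cabs (z - c) <= r & forall w, cabs (w - c) <= r -> v w <= v z.
Proof.
move=> r0 H.
pose P (p : R * R) : C := (p.1 +i* p.2)%C.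
have Pdist p q : cabs (P p - P q) <= `|p.1 - q.1| + `|p.2 - q.2|.
  exact: cabs_pair (p.1 - q.1) (p.2 - q.2).
have Pcont (f : C -> R) p : (forall e : R, 0 < e -> exists2 k : R, 0 < k &
     forall h, cabs h < k -> `|f (P p + h) - f (P p)| < e) ->
     {for p, continuous (f \o P)}.
  move=> Hf; apply/cvgrPdist_lt => e /Hf[k k0 K].
  have k2 : 0 < k / 2 by lra.
  exists (ball p.1 (k / 2), ball p.2 (k / 2)) => /=.
    by split; exact: nbhsx_ballx.
  move=> q [/= q1 q2]; rewrite distrC.
  have := K (P q - P p); rewrite (addrC (P p)) subrK; apply.
  apply: le_lt_trans (Pdist _ _) _; rewrite (distrC q.1) (distrC q.2).
  by move: q1 q2; rewrite /ball /=; lra.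
pose A := [set p : R * R | cabs (P p - c) <= r]%classic.
have cA : compact A.
  apply: (@subclosed_compact _ _ (`[complex.Re c - r, complex.Re c + r] `*`
     `[complex.Im c - r, complex.Im c + r])%classic).
  - rewrite /A -[X in closed X]/((fun p => cabs (P p - c)) @^-1` [set x | x <= r])%classic.
    apply: closed_comp; last exact: closed_le.
    move=> p _; apply: (Pcont (fun z => cabs (z - c))) => e e0; exists e => // h he.
    apply: le_lt_trans (cabs_dist _ _) _.
    by have -> : P p + h - c - (P p - c) = h by ring.
  - by apply: compact_setX; exact: segment_compact.
  - move=> [x y]; rewrite /A /P /= => h; rewrite !in_itv /=.
    have X : `|x - complex.Re c| <= r.
      by apply: le_trans h; have := cre_le ((x +i* y)%C - c); case: (c).
    have Y : `|y - complex.Im c| <= r.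
      apply: le_trans h; case: (c) => a b; rewrite /cabs /= -sqrtr_sqr ler_wsqrtr//.
      by rewrite lerDr sqr_ge0.
    by move: X Y; rewrite !ler_norml; split; lra.
have [||p pA pm] := compact_EVT_max (f:=v \o P) (A:=A) _ cA.
- exists (complex.Re c, complex.Im c); rewrite /A /P /=.
  by have -> : (complex.Re c +i* complex.Im c)%C = c; [case: (c)|rewrite subrr cabs0].
- apply: continuous_in_subspaceT => p /[1!inE] pA.
  by apply: Pcont; exact: H.
- exists (P p); first by rewrite inE in pA.
  move=> w wr; have := pm (complex.Re w, complex.Im w).
  have E : P (complex.Re w, complex.Im w) = w by rewrite /P; case: (w).
  by rewrite /= E; apply; rewrite inE /A /= E.
Qed.

End MeanValue.

(** * Maximum principle and Cauchy estimates *)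

Section TwiceDifferentiable.
Variable R : realType.
Local Notation C := (R[i])^o.
Implicit Types (f g G : C -> C) (c z w h : C).

(** Nothing is assumed about the continuity of [f2]: this is exactly what analyticity of both [f]
    and [f'] provides. *)
Definition twice_der f f1 f2 c (r : R) := forall z, cabs (z - c) < r ->
  cder f z (f1 z) /\ cder f1 z (f2 z).

Definition twice_cder f c r := exists f1 f2, twice_der f f1 f2 c r.

Lemma twice_derB f f1 f2 g g1 g2 c r :
  twice_der f f1 f2 c r -> twice_der g g1 g2 c r ->
  twice_der (fun z => f z - g z) (fun z => f1 z - g1 z) (fun z => f2 z - g2 z) c r.
Proof.
by move=> F Gd z zr; have [a b] := F z zr; have [a' b'] := Gd z zr; split; exact: has_derB.
Qed.

Lemma twice_cder_cst k c r : twice_cder (fun=> k) c r.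
Proof.
by exists (fun=> 0), (fun=> 0) => z _; split; exact: has_der_cst.
Qed.

Lemma twice_cderM f g c r : twice_cder f c r -> twice_cder g c r ->
  twice_cder (fun z => f z * g z) c r.
Proof.
move=> [f1 [f2 F]] [g1 [g2 Gd]].
exists (fun z => f1 z * g z + f z * g1 z).
exists (fun z => f2 z * g z + f1 z * g1 z + (f1 z * g1 z + f z * g2 z)).
move=> z zr; have [a b] := F z zr; have [a' b'] := Gd z zr; split.
  exact: cderM.
by apply: has_derD; exact: cderM.
Qed.

Lemma twice_cderX f c r n : twice_cder f c r -> twice_cder (fun z => f z ^+ n) c r.
Proof.
move=> H; elim: n => [|n IH]; first exact: twice_cder_cst.
have [g1 [g2 Gd]] := twice_cderM H IH; exists g1, g2 => z zr.
have [a b] := Gd z zr; split=> //; apply: has_der_ext a => x.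
by rewrite exprS.
Qed.

Lemma twice_cder_prod (I : Type) (s : seq I) (F : I -> C -> C) c r :
  (forall i, twice_cder (F i) c r) ->
  twice_cder (fun z => \prod_(i <- s) F i z) c r.
Proof.
move=> H; elim: s => [|i s IH].
  have [g1 [g2 Gd]] := twice_cder_cst 1 c r; exists g1, g2 => z /Gd[a b].
  by split=> //; apply: has_der_ext a => x; rewrite big_nil.
have [g1 [g2 Gd]] := twice_cderM (H i) IH; exists g1, g2 => z /Gd[a b].
by split=> //; apply: has_der_ext a => x; rewrite big_cons.
Qed.

Lemma cder_shift f z h d : cder f (z + h) d -> cder (fun x => f (x + h)) z d.
Proof.
move=> H e /H[k k0 K]; exists k => // l /K.
by rewrite (addrAC z l).
Qed.

Lemma cder_invB z c : z != c -> cder (fun x => (x - c)^-1) z (- (z - c) ^- 2).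
Proof.
move=> zc; apply: (cder_shift (f:=fun x : C => x^-1)).
by apply: cderV; rewrite subr_eq0.
Qed.

Lemma twice_cder_invB c z r : r <= cabs (z - c) ->
  twice_cder (fun x => (x - c)^-1) z r.
Proof.
move=> rc; exists (fun x => - (x - c) ^- 2).
exists (fun x => - 1 * (2%:R * (x - c)^-1 ^+ 1 * (- (x - c) ^- 2))).
move=> x xr; have xc : x != c.
  apply: contraTneq xr => ->; by rewrite -leNgt cabsC.
split; first exact: cder_invB.
apply: has_der_ext (has_derZ (-1) (cderX 2 (cder_invB xc))) => y.
by rewrite mulN1r exprVn.
Qed.

(** A unimodular [a] gives an isometry, so the radius is preserved; it serves for the rotated copies
    of [phi] in the necessity part. *)
Lemma twice_cder_affine f c r (a b : C) : cabs a = 1 ->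
  twice_cder f (a * c + b) r -> twice_cder (fun z => f (a * z + b)) c r.
Proof.
move=> a1 [f1 [f2 F]].
have da z : cder (fun z => a * z + b) z a.
  apply: has_der_eqd (has_derD (has_derZ a (cder_id z)) (has_der_cst id b z)) _.
  by rewrite mulr1 addr0.
exists (fun z => a * f1 (a * z + b)), (fun z => a * (a * f2 (a * z + b))).
move=> z zr; have /F[A B] : cabs (a * z + b - (a * c + b)) < r.
  by rewrite opprD addrACA subrr addr0 -mulrBr cabsM a1 mul1r.
split; first exact: has_der_comp (da z) A.
by apply: has_derZ; exact: has_der_comp (da z) B.
Qed.

Lemma cabs_sqr z : cabs z ^+ 2 = complex.Re z ^+ 2 + complex.Im z ^+ 2.
Proof. by case: z => a b; rewrite /cabs /= sqr_sqrtr ?addr_ge0 ?sqr_ge0. Qed.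

Lemma four_point_sqr w (x : R) :
  cabs (w + ofR x) ^+ 2 + cabs (w - ofR x) ^+ 2 + cabs (w + ofR x * 'i%C) ^+ 2
    + cabs (w - ofR x * 'i%C) ^+ 2 = 4 * cabs w ^+ 2 + 4 * x ^+ 2.
Proof. by rewrite !cabs_sqr; case: w => a b /=; ring. Qed.

(* Maximise [|G z| + e |z - c|^2]: at an interior maximum where [G] does not
   vanish, the four-point sum of [Re (u G)], [u] unimodular with
   [u G z0 = |G z0|], is [4 |G z0| + o(x^2)], while that of the quadratic term
   exceeds its central value by [4 e x^2]. *)
Lemma max_principle_near G c (r B : R) : 0 <= r -> 0 <= B ->
  (forall z, cabs (z - c) <= r -> ccontinuous G z) ->
  (forall z, cabs (z - c) < r -> G z != 0 -> exists2 k, 0 < k & twice_cder G z k) ->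
  (forall z, cabs (z - c) = r -> cabs (G z) <= B) ->
  forall z, cabs (z - c) <= r -> cabs (G z) <= B.
Proof.
move=> r0 B0 Gc G2 GB z zr; apply/ler_addgt0Pr => e' e'0.
have R2 : 0 <= r ^+ 2 by rewrite sqr_ge0.
(* With this [e] the penalty [e * cabs (z - c) ^+ 2] is at most [e'] on the disk; the [+ 1] allows
   [r = 0]. *)
pose e := e' / (r ^+ 2 + 1).
have e0 : 0 < e by rewrite divr_gt0//; lra.
have er : e * r ^+ 2 <= e'.
  by rewrite /e mulrAC ler_pdivrMr ?ler_pM2l; lra.
pose v (z : C) := cabs (G z) + e * cabs (z - c) ^+ 2.
have [|z0 z0r zm] := disk_max (v:=v) (c:=c) r0.
  move=> x xr d d0; have [k1 k10 K1] := Gc x xr (d / 2) ltac:(lra).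
  have q0 : 0 < d / 2 / (e * (2 * r + 1)).
    by apply: divr_gt0; [lra|apply: mulr_gt0 => //; lra].
  exists (Num.min k1 (Num.min 1 (d / 2 / (e * (2 * r + 1))))).
    by rewrite !lt_min k10 q0 ltr01.
  move=> h; rewrite !lt_min => /and3P[/K1 A h1].
  rewrite ltr_pdivlMr; last by rewrite mulr_gt0; lra.
  move=> hB; have H0 := cabs_ge0 h.
  have D1 := cabs_dist (G (x + h)) (G x).
  have D2 := cabs_dist (x + h - c) (x - c).
  have E : x + h - c - (x - c) = h by ring.
  rewrite {}E in D2.
  have P1 := cabs_ge0 (x - c); have P2 := cabs_ge0 (x + h - c).
  have E2 : v (x + h) - v x = (cabs (G (x + h)) - cabs (G x)) +
     e * ((cabs (x + h - c) - cabs (x - c)) * (cabs (x + h - c) + cabs (x - c))).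
    by rewrite /v; ring.
  rewrite E2; apply: le_lt_trans (ler_normD _ _) _.
  have : `|e * ((cabs (x + h - c) - cabs (x - c)) * (cabs (x + h - c) + cabs (x - c)))|
     <= d / 2.
    rewrite normrM gtr0_norm// normrM.
    have S0 : `|cabs (x + h - c) + cabs (x - c)| <= 2 * r + 1.
      by move: D2; rewrite !ler_norml; lra.
    apply: le_trans (ltW hB); rewrite [leRHS]mulrCA ler_wpM2l ?(ltW e0)//.
    by apply: ler_pM.
  by lra.
have vz : cabs (G z) <= v z0.
  apply: le_trans (zm z zr); rewrite /v lerDl mulr_ge0 ?(ltW e0)//.
  by rewrite exprn_ge0 ?cabs_ge0.
have vr : e * cabs (z0 - c) ^+ 2 <= e'.
  by apply: le_trans er; rewrite ler_wpM2l ?(ltW e0)// lerXn2r ?nnegrE ?cabs_ge0.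
(* On the boundary [GB] bounds [G z0], and at a zero of [G] only the penalty remains. In the
   remaining case a contradiction is derived. *)
have [z0b|z0i] := eqVneq (cabs (z0 - c)) r.
  by apply: le_trans vz _; apply: lerD => //; exact: GB.
have [G0|G0] := eqVneq (G z0) 0.
  by apply: le_trans vz _; rewrite /v G0 cabs0; lra.
have {z0i} z0i : cabs (z0 - c) < r by rewrite lt_neqAle z0i.
have [k k0 [G1 [d2 D]]] := G2 _ z0i G0.
have DG h : cabs h < k -> cder G (z0 + h) (G1 (z0 + h)).
  by move=> hk; case: (D (z0 + h)) => //; rewrite addrAC subrr add0r.
have DG1 : cder G1 z0 (d2 z0) by case: (D z0); rewrite // subrr cabs0.
have [l l0 L] := four_point_littleo k0 DG DG1 e0.
pose x := Num.min l (r - cabs (z0 - c)) / 2.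
have [x0 xl xr] : [/\ 0 < x, x < l & x < r - cabs (z0 - c)].
  have : 0 < Num.min l (r - cabs (z0 - c)) by rewrite lt_min l0; lra.
  have : Num.min l (r - cabs (z0 - c)) <= l by rewrite ge_min lexx.
  have : Num.min l (r - cabs (z0 - c)) <= r - cabs (z0 - c) by rewrite ge_min lexx orbT.
  by rewrite /x; split; lra.
have [u u1 uE] := cabs_phase (G z0).
have iE : cabs ('i%C : C) = 1 by rewrite /cabs /= expr0n/= add0r expr1n sqrtr1.
have step (b : C) : cabs b = x -> cre (u * G (z0 + b)) + e * cabs (z0 - c + b) ^+ 2 <= v z0.
  move=> bx; apply: le_trans (zm (z0 + b) _).
    rewrite /v addrAC lerD2r; apply: le_trans (cre_le_cabs _) _.
    by rewrite cabsM u1 mul1r.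
  by rewrite addrAC; apply: le_trans (cabsD _ _) _; lra.
have xE : cabs (ofR x) = x by rewrite cabs_ofR gtr0_norm.
have xiE : cabs (ofR x * 'i%C) = x by rewrite cabsM xE iE mulr1.
have s1 := step _ xE; have s2 := step (- ofR x) (etrans (cabsN _) xE).
have s3 := step _ xiE; have s4 := step (- (ofR x * 'i%C)) (etrans (cabsN _) xiE).
have := L x x0 xl; set Sg := (X in cabs X) => SB.
have SE : cre (u * Sg) = cre (u * G (z0 + ofR x)) + cre (u * G (z0 - ofR x)) +
   cre (u * G (z0 + ofR x * 'i%C)) + cre (u * G (z0 - ofR x * 'i%C)) - 4 * cabs (G z0).
  have -> : 4 * cabs (G z0) = cre (ofR 4 * (u * G z0)) by rewrite creZ uE.
  have -> : ofR 4 = 4 :> C by exact: ofR_nat.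
  by rewrite -!creD -creB; congr cre; rewrite /Sg; ring.
have Sl : - (e * x ^+ 2) <= cre (u * Sg).
  have := cre_le (u * Sg); rewrite cabsM u1 mul1r ler_norml => /andP[a _].
  by apply: le_trans a; rewrite lerN2.
have FS := four_point_sqr (z0 - c) x.
have vE : v z0 = cabs (G z0) + e * cabs (z0 - c) ^+ 2 by [].
have ex0 : 0 < e * x ^+ 2 by rewrite mulr_gt0// exprn_gt0.
have : e * (cabs (z0 - c + ofR x) ^+ 2 + cabs (z0 - c - ofR x) ^+ 2 + cabs (z0 - c + ofR x * 'i%C) ^+ 2
    + cabs (z0 - c - ofR x * 'i%C) ^+ 2) = 4 * (e * cabs (z0 - c) ^+ 2) + 4 * (e * x ^+ 2).
  by rewrite FS; ring.
(* The inequalities [s1] to [s4] add up to at most [4 * v z0], while [Sl] and [FS] make the same sum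
   at least [4 * v z0 + 3 * (e * x ^+ 2)]. *)
lra.
Qed.

Lemma max_principle G c (r r' B : R) : 0 <= r -> r < r' -> 0 <= B ->
  twice_cder G c r' -> (forall z, cabs (z - c) = r -> cabs (G z) <= B) ->
  forall z, cabs (z - c) <= r -> cabs (G z) <= B.
Proof.
move=> r0 rr' B0 [G1 [G2 D]]; apply: max_principle_near => //.
- move=> z zr; have [|+ _] := D z; first lra.
  exact: cder_ccontinuous.
- move=> z zr _; exists (r' - r); first lra.
  exists G1, G2 => w wz; apply: D.
  have -> : w - c = (w - z) + (z - c) by ring.
  by apply: le_lt_trans (cabsD _ _) _; lra.
Qed.

Lemma bernoulli (x : R) n : - 1 <= x -> 1 + n%:R * x <= (1 + x) ^+ n.
Proof.
move=> x0; elim: n => [|n IH]; first by rewrite expr0 mul0r addr0.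
rewrite exprS; apply: le_trans (ler_wpM2l _ IH); last lra.
have N0 : 0 <= n%:R * x * x by rewrite -mulrA mulr_ge0// -expr2 sqr_ge0.
by rewrite -addn1 natrD; nra.
Qed.

Lemma archi_gt (x : R) : exists n : nat, x < n%:R.
Proof.
exists (Num.bound `|x|); apply: le_lt_trans (ler_norm x) _.
exact: archi_boundP.
Qed.

(** If [a > b > 0], Bernoulli's inequality makes [(a / b) ^+ n.+1] grow at least linearly, past
    [K / t]. Thus factors independent of [n] disappear from an estimate on all powers. *)
Lemma le_of_expr_le (a b t K : R) : 0 <= b -> 0 < t ->
  (forall n, a ^+ n.+1 * t <= b ^+ n.+1 * K) -> a <= b.
Proof.
move=> b0 t0 H; rewrite leNgt; apply/negP => ab.
have [bE|bn] := eqVneq b 0.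
  by have := H 0%N; rewrite !expr1 bE mul0r leNgt mulr_gt0// -bE.
have {}b0 : 0 < b by rewrite lt_def bn.
pose x := a / b - 1.
have x0 : 0 < x by rewrite subr_gt0 ltr_pdivlMr ?mul1r.
have [n nK] := archi_gt (K / (t * x)).
have tx : 0 < t * x by rewrite mulr_gt0.
move: nK; rewrite ltr_pdivrMr// => nK.
have := H n; have aE : a = b * (1 + x) by rewrite /x addrC subrK mulrC divfK.
rewrite [in leLHS]aE exprMn -mulrA ler_pM2l ?exprn_gt0//.
have := @bernoulli x n.+1 ltac:(lra) => B /(le_trans (ler_wpM2r (ltW t0) B)).
by rewrite -addn1 natrD; nra.
Qed.

Lemma cder_bound f z d (k L : R) : 0 < k -> cder f z d ->
  (forall h, h != 0 -> cabs h < k -> cabs (f (z + h) - f z) <= L * cabs h) ->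
  cabs d <= L.
Proof.
move=> k0 D H; apply/ler_addgt0Pr => e e0; have [l l0 K] := D e e0.
pose x := Num.min k l / 2.
have m0 : 0 < Num.min k l by rewrite lt_min k0.
have mk : Num.min k l <= k by rewrite ge_min lexx.
have ml : Num.min k l <= l by rewrite ge_min lexx orbT.
have x0 : 0 < x by rewrite /x; lra.
have xE : cabs (ofR x) = x by rewrite cabs_ofR gtr0_norm.
have xn : ofR x != 0 by rewrite -cabs_gt0 xE.
have xk : cabs (ofR x) < k by rewrite xE /x; lra.
have xl : cabs (ofR x) < l by rewrite xE /x; lra.
have A := H _ xn xk; have B := K _ xl.
have := cabs_leB (ofR x * d) (f (z + ofR x) - f z).
rewrite (cabsC (_ * _)) cabsM; move: A B; rewrite xE => A B T.
rewrite -(ler_pM2l x0); lra.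
Qed.

(* Schwarz's lemma for [q z = (f z - f c) / (z - c)] without removing the
   singularity: [q^(n+1) (z - c)] is continuous at [c] and vanishes there, the
   maximum principle applies to it, and one lets [n] tend to infinity. *)
Lemma cauchy_estimate f f1 f2 c (r S : R) : 0 < r -> twice_der f f1 f2 c r ->
  (forall z, cabs (z - c) < r -> cabs (f z) <= S) -> cabs (f1 c) <= 4 * S / r.
Proof.
move=> r0 D fS; pose s := r / 2; have s0 : 0 < s by rewrite /s; lra.
have cc : cabs (c - c) < r by rewrite subrr cabs0.
have S0 : 0 <= S by apply: le_trans (fS c cc); exact: cabs_ge0.
have fB z : cabs (z - c) < r -> cabs (f z - f c) <= 2 * S.
  by move=> zr; apply: le_trans (cabsB _ _) _; have := fS z zr; have := fS c cc; lra.
(* Off [c] this is [q ^+ n.+1 * (z - c)]; at [c] it is 0 thanks to the factor [f z - f c], whatever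
   value [0^-1] has. *)
pose H n (z : C) := (f z - f c) ^+ n.+1 * (z - c)^-1 ^+ n.
have H2 n z : cabs (z - c) <= s -> z != c -> exists2 k, 0 < k & twice_cder (H n) z k.
  move=> zs zc; have zc0 : 0 < cabs (z - c) by rewrite cabs_gt0 subr_eq0.
  exists (Num.min s (cabs (z - c))); first by rewrite lt_min s0.
  apply: twice_cderM; apply: twice_cderX.
    exists f1, f2 => w; rewrite lt_min => /andP[ws _].
    have [|a b] := D w.
      have -> : w - c = (w - z) + (z - c) by ring.
      by apply: le_lt_trans (cabsD _ _) _; move: ws zs; rewrite /s; lra.
    split=> //; apply: has_der_eqd (has_derB a (has_der_cst id (f c) w)) _.
    by rewrite subr0.
  by apply: twice_cder_invB; rewrite ge_min lexx orbT.
have Hbd n z : cabs (z - c) <= s -> cabs (H n z) <= (2 * S) ^+ n.+1 * s^-1 ^+ n.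
  apply: max_principle_near; first lra.
  - by rewrite mulr_ge0 ?exprn_ge0 ?invr_ge0//; lra.
  - move=> w ws; have [wc|wc] := eqVneq w c; last first.
      have [k k0 [G1 [G2 Gd]]] := H2 n w ws wc.
      have [|+ _] := Gd w; first by rewrite subrr cabs0.
      exact: cder_ccontinuous.
    move=> e e0; have [/has_der_lip[k k0 K] _] := D c cc.
    have A0 := cabs_ge0 (f1 c).
    have q0 : 0 < e / (cabs (f1 c) + 1) ^+ n.+1.
      by rewrite divr_gt0// exprn_gt0//; lra.
    exists (Num.min k (e / (cabs (f1 c) + 1) ^+ n.+1)); first by rewrite lt_min k0.
    move=> h; rewrite lt_min wc => /andP[/K fh].
    rewrite ltr_pdivlMr; last by rewrite exprn_gt0//; lra.
    have -> : H n c = 0 by rewrite /H subrr exprS mul0r mul0r.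
    rewrite subr0 /H addrAC subrr add0r cabsM !cabsX cabsV.
    have [->|hn] := eqVneq h 0.
      by move=> _; rewrite addr0 subrr cabs0 exprS !mul0r.
    have h0 : 0 < cabs h by rewrite cabs_gt0.
    apply: le_lt_trans.
    have -> : cabs h * (cabs (f1 c) + 1) ^+ n.+1 =
        ((cabs (f1 c) + 1) * cabs h) ^+ n.+1 * (cabs h)^-1 ^+ n.
      rewrite exprMn exprVn [cabs h ^+ n.+1]exprS -!mulrA divff ?mulr1 1?mulrC//.
      by rewrite expf_neq0// gt_eqF.
    apply: ler_wpM2r; first by rewrite exprn_ge0// invr_ge0 cabs_ge0.
    by rewrite lerXn2r ?nnegrE ?cabs_ge0// mulr_ge0//; lra.
  (* Since [H n] vanishes at [c], no derivative is asked for at the singularity. *)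
  - move=> w ws Hw; apply: H2; first exact: ltW.
    by apply: contra_neq Hw => ->; rewrite /H subrr exprS mul0r mul0r.
  - move=> w ws; rewrite /H cabsM !cabsX cabsV ws.
    rewrite ler_wpM2r ?exprn_ge0 ?invr_ge0 ?(ltW s0)//.
    rewrite lerXn2r ?nnegrE ?cabs_ge0//; first lra.
    by apply: fB; rewrite ws /s; lra.
have -> : 4 * S / r = 2 * S / s by rewrite /s; field; apply/eqP; lra.
have [Dc _] := D c cc; apply: (cder_bound s0 Dc) => h h0 hs.
have hp : 0 < cabs h by rewrite cabs_gt0.
rewrite -ler_pdivrMr// ler_pdivlMr//.
(* The single factors [cabs h] and [s], left over from [z - c] at [c + h] and on the circle, do not
   depend on [n]. *)
apply: (@le_of_expr_le _ _ (cabs h) s) => //; first lra.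
move=> n; have := Hbd n (c + h); rewrite addrAC subrr add0r => /(_ (ltW hs)).
rewrite /H addrAC subrr add0r cabsM !cabsX cabsV.
set q := cabs (_ - _); rewrite !exprVn => T.
have sn : 0 < s ^+ n.+1 by rewrite exprn_gt0.
have -> : (q / cabs h * s) ^+ n.+1 * cabs h = q ^+ n.+1 / cabs h ^+ n * s ^+ n.+1.
  rewrite !exprMn exprVn [cabs h ^+ n.+1]exprS; field.
  by rewrite expf_neq0 ?gt_eqF.
have -> : (2 * S) ^+ n.+1 * s = (2 * S) ^+ n.+1 / s ^+ n * s ^+ n.+1.
  rewrite [s ^+ n.+1]exprS; field.
  by rewrite expf_neq0 ?gt_eqF.
by rewrite ler_pM2r.
Qed.

End TwiceDifferentiable.

(** * Bounds for the second derivative and its differentiability *)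

Section Regularity.
Variable R : realType.
Local Notation C := (R[i])^o.
Implicit Types (f g G : C -> C) (c z w h : C).

Definition diff_quot f h z : C := h^-1 * (f (z + h) - f z).

Lemma twice_der_diff_quot f f1 f2 c (r r' : R) h : cabs h <= r - r' ->
  twice_der f f1 f2 c r ->
  twice_der (diff_quot f h) (diff_quot f1 h) (diff_quot f2 h) c r'.
Proof.
move=> hr D z zr.
have [|a b] := D z; first by have := cabs_ge0 h; lra.
have [|a' b'] := D (z + h).
  by rewrite addrAC; apply: le_lt_trans (cabsD _ _) _; lra.
by split; apply: has_derZ; apply: has_derB => //; exact: cder_shift.
Qed.

Lemma twice_der_sub f f1 f2 c z (r r' : R) : cabs (z - c) <= r - r' ->
  twice_der f f1 f2 c r -> twice_der f f1 f2 z r'.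
Proof.
move=> zr D w wr; apply: D; have -> : w - c = (w - z) + (z - c) by ring.
by apply: le_lt_trans (cabsD _ _) _; lra.
Qed.

Lemma cauchy_estimate_near f f1 f2 c (r S : R) z : 0 < r -> twice_der f f1 f2 c r ->
  (forall z, cabs (z - c) < r -> cabs (f z) <= S) -> cabs (z - c) < r / 2 ->
  cabs (f1 z) <= 8 * S / r.
Proof.
move=> r0 D fS zr; have -> : 8 * S / r = 4 * S / (r / 2).
  by field; apply/eqP; lra.
apply: (cauchy_estimate (f:=f) (f2:=f2)); first lra.
  by apply: twice_der_sub D; lra.
move=> w wz; apply: fS; have -> : w - c = (w - z) + (z - c) by ring.
by apply: le_lt_trans (cabsD _ _) _; lra.
Qed.

Lemma ball_segment c z w (r : R) (s : R) : 0 <= s <= 1 ->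
  cabs (z - c) < r -> cabs (w - c) < r -> cabs (z + ofR s * (w - z) - c) < r.
Proof.
move=> /andP[s0 s1] zr wr.
have -> : z + ofR s * (w - z) - c = ofR (1 - s) * (z - c) + ofR s * (w - c).
  by rewrite ofRB ofR1; ring.
apply: le_lt_trans (cabsD _ _) _; rewrite !cabsM !cabs_ofR !ger0_norm//; last lra.
by have [->|sn] := eqVneq s 0; [lra|have : 0 < s by [rewrite lt_def sn]; nra].
Qed.

(** [cauchy_estimate] does not apply to [f1], which is not known to be twice differentiable. It is
    applied to the difference quotients of [f]: the bound on [f1] bounds them uniformly in [h], and
    their derivatives at [c] are the difference quotients of [f1]. *)
Lemma cauchy_estimate2 f f1 f2 c (r S : R) : 0 < r -> twice_der f f1 f2 c r ->
  (forall z, cabs (z - c) < r -> cabs (f z) <= S) ->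
  cabs (f2 c) <= 128 * S / r ^+ 2.
Proof.
move=> r0 D fS.
have cc : cabs (c - c) < r by rewrite subrr cabs0.
have [_ D2] := D c cc.
have f1S z : cabs (z - c) < r / 2 -> cabs (f1 z) <= 8 * S / r.
  by move=> zr; exact: (cauchy_estimate_near (f:=f) (f2:=f2)) zr.
have r4 : 0 < r / 4 by lra.
apply: (cder_bound r4 D2) => h h0 hr.
have hp : 0 < cabs h by rewrite cabs_gt0.
have qD : twice_der (diff_quot f h) (diff_quot f1 h) (diff_quot f2 h) c (r / 4).
  by apply: twice_der_diff_quot D; lra.
have := cauchy_estimate (S:=8 * S / r) r4 qD.
rewrite /diff_quot cabsM cabsV ler_pdivrMl//.
have -> : 4 * (8 * S / r) / (r / 4) = 128 * S / r ^+ 2.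
  by field; apply/eqP; lra.
rewrite (mulrC (cabs h)); apply=> z zr.
rewrite cabsM cabsV ler_pdivrMl// mulrC.
have := @segment_mean_value R f f1 (8 * S / r) z (z + h).
have -> : z + h - z = h by ring.
apply => s s01.
have sb : cabs (z + ofR s * h - c) < r / 2.
  have -> : z + ofR s * h = z + ofR s * ((z + h) - z) by ring.
  apply: ball_segment => //; first lra.
  by rewrite addrAC; apply: le_lt_trans (cabsD _ _) _; lra.
by split; [case: (D (z + ofR s * h)) => //; lra|exact: f1S].
Qed.

(** Completeness in the form of nested intervals: [d] is the supremum of the lower ends [a x - l x],
    each of which lies below every upper end [a y + l y]. *)
Lemma cauchy_cut (T : Type) (P : T -> Prop) (a l : T -> R) (x0 : T) : P x0 ->
  (forall x y, P x -> P y -> a x - l x <= a y + l y) ->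
  exists d, forall x, P x -> `|a x - d| <= l x.
Proof.
move=> P0 H; pose E := [set a x - l x | x in [set x | P x]]%classic.
have E0 : (E !=set0)%classic by exists (a x0 - l x0); exists x0.
have Eb y : P y -> ubound E (a y + l y) by move=> Py _ [x Px <-]; exact: H.
exists (sup E) => x Px; rewrite ler_distlC; apply/andP; split.
  by apply: ub_le_sup; [exists (a x0 + l x0); exact: Eb|exists x].
by apply: ge_sup => //; exact: Eb.
Qed.

(* The difference quotients of [f] form a Cauchy net on a small disk; by the
   Cauchy estimate so do their second derivatives, which are the difference
   quotients of [f2]. *)
Lemma second_derivative_cder f f1 f2 c (r : R) : 0 < r ->
  twice_der f f1 f2 c r -> exists d, cder f2 c d.
Proof.
move=> r0 D.
have cc : cabs (c - c) < r by rewrite subrr cabs0.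
have [/cder_ccontinuous/(_ 1 ltr01)[k k0 fk] _] := D c cc.
(* Continuity at [c] gives a radius on which [f] is bounded, as the Cauchy estimates require. *)
pose p := Num.min k r; pose S := cabs (f c) + 1.
have pk : p <= k by rewrite ge_min lexx.
have pr : p <= r by rewrite ge_min lexx orbT.
have p0 : 0 < p by rewrite lt_min k0.
have {}D : twice_der f f1 f2 c p by apply: twice_der_sub D; rewrite subrr cabs0; lra.
have fS z : cabs (z - c) < p -> cabs (f z) <= S.
  move=> zp; have := fk (z - c) (lt_le_trans zp pk).
  have -> : c + (z - c) = z by ring.
  by move=> A; have := cabs_leB (f z) (f c); rewrite /S; lra.
pose S2 := 128 * S / (p / 2) ^+ 2.
have f2S z : cabs (z - c) < p / 2 -> cabs (f2 z) <= S2.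
  move=> zr; apply: (cauchy_estimate2 (f:=f) (f1:=f1)); first lra.
    by apply: twice_der_sub D; lra.
  move=> w wz; apply: fS; have -> : w - c = (w - z) + (z - c) by ring.
  by apply: le_lt_trans (cabsD _ _) _; lra.
have f1L z w : cabs (z - c) < p / 2 -> cabs (w - c) < p / 2 ->
    cabs (f1 w - f1 z) <= S2 * cabs (w - z).
  move=> zp wp; apply: (segment_mean_value (f':=f2)) => s s01.
  have b := ball_segment s01 zp wp.
  by split; [case: (D (z + ofR s * (w - z))) => //; lra|exact: f2S].
have Q h z : h != 0 -> cabs h < p / 4 -> cabs (z - c) < p / 4 ->
    cabs (diff_quot f h z - f1 z) <= S2 * cabs h.
  move=> h0 hp zp; have h1 : 0 < cabs h by rewrite cabs_gt0.
  (* Subtracting the linear function [w * f1 z] from [f w] leaves the derivative [f1 w - f1 z],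
     small by the Lipschitz bound [f1L]. *)
  have -> : diff_quot f h z - f1 z =
      h^-1 * ((f (z + h) - (z + h) * f1 z) - (f z - z * f1 z)).
    by rewrite /diff_quot; field.
  rewrite cabsM cabsV ler_pdivrMl// (mulrC (cabs h)).
  have S2h : 0 <= S2 by apply: le_trans (f2S c _); rewrite ?cabs_ge0// subrr cabs0; lra.
  have := @segment_mean_value R (fun w => f w - w * f1 z) (fun w => f1 w - f1 z)
    (S2 * cabs h) z (z + h).
  have -> : z + h - z = h by ring.
  apply => s s01.
  have hz : cabs (z + h - c) < p / 2.
    by rewrite addrAC; apply: le_lt_trans (cabsD _ _) _; lra.
  have zp2 : cabs (z - c) < p / 2 by lra.
  have sb : cabs (z + ofR s * h - c) < p / 2.
    have -> : z + ofR s * h = z + ofR s * ((z + h) - z) by ring.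
    exact: ball_segment.
  split.
    apply: has_derB; first by case: (D (z + ofR s * h)) => //; lra.
    apply: has_der_ext (has_der_eqd (has_derZ (f1 z) (cder_id _)) (mulr1 _)) => x.
    by rewrite mulrC.
  apply: le_trans (f1L _ _ zp2 sb) _; rewrite ler_wpM2l//.
  rewrite addrAC subrr add0r cabsM cabs_ofR.
  case/andP: s01 => s0 s1; rewrite ger0_norm//; nra.
pose L := 128 / (p / 4) ^+ 2 * S2.
pose P h := h != 0 /\ cabs h < p / 4.
have DL h h' : P h -> P h' ->
    cabs (diff_quot f2 h c - diff_quot f2 h' c) <= L * cabs h + L * cabs h'.
  move=> [h0 hp] [h'0 h'p].
  have -> : L * cabs h + L * cabs h' = 128 * (S2 * (cabs h + cabs h')) / (p / 4) ^+ 2.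
    by rewrite /L; field; apply/eqP; lra.
  apply: (@cauchy_estimate2 (fun z => diff_quot f h z - diff_quot f h' z)
    (fun z => diff_quot f1 h z - diff_quot f1 h' z)
    (fun z => diff_quot f2 h z - diff_quot f2 h' z)); first lra.
    by apply: twice_derB; apply: twice_der_diff_quot D; lra.
  move=> z zp.
  have -> : diff_quot f h z - diff_quot f h' z =
    (diff_quot f h z - f1 z) - (diff_quot f h' z - f1 z) by ring.
  by apply: le_trans (cabsB _ _) _; rewrite mulrDr lerD// Q.
have P0 : P (ofR (p / 8)).
  split; first by rewrite -cabs_gt0 cabs_ofR gtr0_norm; lra.
  by rewrite cabs_ofR gtr0_norm; lra.
have [dr Hr] : exists d, forall h, P h -> `|complex.Re (diff_quot f2 h c) - d| <= L * cabs h.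
  apply: cauchy_cut P0 _ => h h' Ph Ph'; have := DL h h' Ph Ph'.
  by have := cre_le_cabs (diff_quot f2 h c - diff_quot f2 h' c); rewrite creB /cre; lra.
have [di Hi] : exists d, forall h, P h -> `|complex.Im (diff_quot f2 h c) - d| <= L * cabs h.
  apply: cauchy_cut P0 _ => h h' Ph Ph'; have := DL h h' Ph Ph'.
  have : complex.Im (diff_quot f2 h c) - complex.Im (diff_quot f2 h' c) <=
      cabs (diff_quot f2 h c - diff_quot f2 h' c).
    case: (diff_quot f2 h c) (diff_quot f2 h' c) => [a b] [a' b'].
    rewrite /cabs /=; apply: le_trans (ler_norm _) _.
    by rewrite -sqrtr_sqr ler_wsqrtr// lerDr sqr_ge0.
  lra.
have L0 : 0 <= L.
  by have := Hr _ P0; have := normr_ge0 (complex.Re (diff_quot f2 (ofR (p / 8)) c) - dr);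
    have := cabs_ge0 (ofR (p / 8)); rewrite cabs_ofR gtr0_norm; nra.
exists (dr +i* di)%C => e e0.
(* The real and the imaginary part each contribute an error [L * cabs h]. *)
have L1 : 0 < 2 * L + 1 by lra.
have q0 : 0 < e / (2 * L + 1) by rewrite divr_gt0.
exists (Num.min (p / 4) (e / (2 * L + 1))); first by rewrite lt_min q0; lra.
move=> h; rewrite lt_min => /andP[hp]; rewrite ltr_pdivlMr// => he.
have [->|h0] := eqVneq h 0.
  by rewrite addr0 subrr mul0r subr0 cabs0 mulr0.
have -> : f2 (c + h) - f2 c - h * (dr +i* di)%C = h * (diff_quot f2 h c - (dr +i* di)%C).
  by rewrite /diff_quot; field.
rewrite cabsM mulrC ler_wpM2r ?cabs_ge0//.
have A := Hr h (conj h0 hp); have B := Hi h (conj h0 hp).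
have : cabs (diff_quot f2 h c - (dr +i* di)%C) <= L * cabs h + L * cabs h.
  case: (diff_quot f2 h c) A B => [a b] /= A B.
  exact: le_trans (cabs_pair _ _) (lerD A B).
by have := cabs_ge0 h; nra.
Qed.

End Regularity.

(** * Oscillation on circles *)

Section CircleCurve.
Variable R : realType.
Local Notation C := (R[i])^o.
Implicit Types (f g : C -> C) (z w : C).

Lemma rder_pair (f g : R -> R) (t a b : R) : is_derive t 1 f a -> is_derive t 1 g b ->
  rder (fun s => (f s +i* g s)%C : C) t (a +i* b)%C.
Proof.
move=> /(@is_derive_numfieldP R) F /(@is_derive_numfieldP R) G e e0.
have e2 : 0 < e / 2 by lra.
have [k k0 K] := F _ e2; have [l l0 L] := G _ e2.
exists (Num.min k l); first by rewrite lt_min k0.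
move=> h; rewrite cabs_ofR lt_min => /andP[/K A /L B].
have -> : ((f (t + h) +i* g (t + h)) - (f t +i* g t) - ofR h * (a +i* b))%C =
  ((f (t + h) - f t - h * a) +i* (g (t + h) - g t - h * b))%C :> C.
  by apply/eqP; rewrite eq_complex /=; apply/andP; split; apply/eqP; ring.
by apply: le_trans (cabs_pair _ _) _; lra.
Qed.

Lemma rder_expi (t : R) : rder (@expi R) t ('i%C * expi t).
Proof.
apply: has_der_eqd (rder_pair (is_derive_cos t) (is_derive_sin t)) _.
by rewrite /expi; apply/eqP; rewrite eq_complex /=; apply/andP; split; apply/eqP; ring.
Qed.

Lemma cabs_expi (t : R) : cabs (expi t) = 1.
Proof. by rewrite /cabs /= cos2Dsin2 sqrtr1. Qed.

Lemma cabs_i : cabs ('i%C : C) = 1.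
Proof. by rewrite /cabs /= expr0n/= add0r expr1n sqrtr1. Qed.

Lemma expiD (s t : R) : expi (s + t) = expi s * expi t.
Proof.
rewrite /expi cosD sinD; apply/eqP; rewrite eq_complex /=.
by apply/andP; split; apply/eqP; ring.
Qed.

Lemma expi_period (t : R) : expi (t + 2 * pi) = expi t.
Proof. by rewrite /expi mulr_natl cosD2pi sinD2pi. Qed.

Lemma rder_circle (r t : R) :
  rder (fun s => ofR r * expi s) t ('i%C * (ofR r * expi t)).
Proof. by apply: has_der_eqd (has_derZ (ofR r) (rder_expi t)) _; ring. Qed.

Lemma cabs_circle (r t : R) : 0 <= r -> cabs (ofR r * expi t) = r.
Proof. by move=> r0; rewrite cabsM cabs_expi mulr1 cabs_ofR ger0_norm. Qed.

Lemma unit_circle_angle (x y : R) : x ^+ 2 + y ^+ 2 = 1 ->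
  exists2 t : R, 0 <= t < 2 * pi & cos t = x /\ sin t = y.
Proof.
move=> xy; have x1 : -1 <= x <= 1 by apply/andP; split; nra.
have sx : sin (acos x) = `|y|.
  by rewrite sin_acos// -xy addrAC subrr add0r sqrtr_sqr.
have cx : cos (acos x) = x by rewrite acosK// in_itv.
have a0 := acos_ge0 x1; have ap := acos_lepi x1; have p0 := pi_gt0 R.
have [y0|y0] := leP 0 y.
  by exists (acos x); [apply/andP; split; lra|rewrite cx sx ger0_norm].
(* [acos] only reaches the upper half circle, so the angle is reflected. It stays below [2 * pi]
   because [acos x = 0] would force [y = 0]. *)
exists (2 * pi - acos x).
  apply/andP; split; first lra.
  rewrite ltrBlDr ltrDl lt_def a0 andbT; apply/eqP => a0E.
  by move: sx; rewrite a0E sin0 ltr0_norm//; lra.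
have := expi_period (- acos x).
rewrite addrC /expi cosN sinN cx sx ltr0_norm// opprK => -[-> ->].
by [].
Qed.

Lemma polar_form z : exists2 t : R, 0 <= t < 2 * pi & z = ofR (cabs z) * expi t.
Proof.
have [->|z0] := eqVneq z 0.
  exists 0; first by rewrite lexx/= mulr_gt0 ?pi_gt0.
  by rewrite cabs0 mul0r.
have r0 : 0 < cabs z by rewrite cabs_gt0.
have [|t tp [ct st]] := @unit_circle_angle (complex.Re z / cabs z) (complex.Im z / cabs z).
  rewrite !expr_div_n -mulrDl -cabs_sqr divff//.
  by rewrite expf_neq0 ?gt_eqF.
exists t => //; rewrite /expi ct st; case: (z) (r0) => a b r1.
apply/eqP; rewrite eq_complex /=.
by apply/andP; split; apply/eqP; field; rewrite gt_eqF.
Qed.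

(** Where [w > a], the factor [(w / a) ^ (p - 1)] exceeds 1. The threshold [a] stays free, to be
    tuned to the size of the integral or to the length of an arc. *)
Lemma young_powR (p a w : R) : 1 < p -> 0 < a -> 0 <= w ->
  w <= a + a `^ (1 - p) * w `^ p.
Proof.
move=> p1 a0 w0; have [wa|aw] := leP w a.
  by apply: le_trans wa _; rewrite lerDl mulr_ge0 ?powR_ge0.
have w1 : 0 < w by lra.
have -> : 1 - p = - (p - 1) by ring.
rewrite powRN -(mulr_powRB1 w0)//; last lra.
rewrite (le_trans _ (_ : w * (w `^ (p - 1) / a `^ (p - 1)) <= _))//.
  rewrite ler_peMr// ler_pdivlMr ?powR_gt0// mul1r.
  by apply: ge0_ler_powR; rewrite ?nnegrE; lra.
rewrite (_ : _^-1 * _ = w * (w `^ (p - 1) / a `^ (p - 1))) ?lerDr ?ltW//; ring.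
Qed.

Lemma measurable_EFin_powR (D : set R) (w : R -> R) (p : R) : continuous w ->
  measurable_fun D (EFin \o (fun t => w t `^ p)).
Proof.
move=> cw; apply/measurable_EFinP.
apply: (measurableT_comp (measurable_powR p)).
apply: measurable_funS (continuous_measurable_fun cw) => //.
Qed.

(* [w <= a + a^(1-p) w^p] replaces the use of Hoelder's inequality. *)
Lemma oscillation_real (p a k A t1 t2 : R) (w h dh : R -> R) :
  1 < p -> 0 < a -> 0 <= k -> 0 <= t1 -> t1 <= t2 -> t2 <= 2 * pi ->
  continuous w -> (forall t, 0 <= w t) ->
  (\int[lebesgue_measure]_(t in `[0%R, (2 * pi)%R]) ((w t) `^ p)%:E <= A%:E)%E ->
  (forall t : R, is_derive t 1 h (dh t)) -> continuous dh ->
  (forall t, t1 <= t <= t2 -> `|dh t| <= k * w t) ->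
  h t2 - h t1 <= k * (a * (t2 - t1) + a `^ (1 - p) * A).
Proof.
move=> p1 a0 k0 t10 t12 t2p cw w0 wA hd cdh hw.
have A0 : 0 <= A.
  by rewrite -lee_fin; apply: le_trans wA; apply: integral_ge0 => t _; rewrite lee_fin powR_ge0.
have b0 : 0 <= a `^ (1 - p) := powR_ge0 _ _.
(* The fundamental theorem of calculus and the length of [I] are used below for [t1 < t2]. *)
have [->|t12n] := eqVneq t1 t2.
  by rewrite !subrr mulr0 add0r !mulr_ge0.
have {t12n} t12 : t1 < t2 by rewrite lt_neqAle t12n.
pose I := `[t1, t2]%classic : set R.
have mI : measurable I by exact: measurable_itv.
have ch : continuous h by move=> t; exact: is_derive_continuous (hd t).
have FTC : (\int[lebesgue_measure]_(t in I) (dh t)%:E = (h t2 - h t1)%:E)%E.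
  rewrite EFinB; apply: continuous_FTC2 => //.
  - exact: continuous_subspaceT.
  - split; first by move=> t _; case: (hd t).
      by apply: cvg_at_right_filter; exact: ch.
    by apply: cvg_at_left_filter; exact: ch.
  - by move=> t _; rewrite derive1E; case: (hd t).
have mdh : measurable_fun I (EFin \o dh).
  apply/measurable_EFinP.
  exact: measurable_funS (continuous_measurable_fun cdh).
have mwp (D : set R) : measurable_fun D (EFin \o (fun t => w t `^ p)).
  exact: measurable_EFin_powR.
rewrite -lee_fin -FTC; apply: le_trans (lee_abs _) _.
apply: le_trans (le_abse_integral (@lebesgue_measure R) mI mdh) _.
apply: (@le_trans _ _ (\int[lebesgue_measure]_(t in I)
    ((k * a)%:E + (k * a `^ (1 - p))%:E * (w t `^ p)%:E))%E).
  apply: ge0_le_integral => //.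
  - exact: measurableT_comp.
  - apply: emeasurable_funD; first exact: measurable_cst.
    by apply: measurable_funeM; exact: mwp.
  - move=> t tI; rewrite /= lee_fin; apply: le_trans (hw t _) _.
      by move: tI; rewrite /I /= in_itv.
    rewrite -mulrA -mulrDr ler_wpM2l//; exact: young_powR.
rewrite ge0_integralD//; first last.
- by apply: measurable_funeM; exact: mwp.
- by move=> t _; rewrite lee_fin !mulr_ge0 ?powR_ge0.
- by move=> t _; rewrite lee_fin mulr_ge0// ltW.
rewrite ge0_integralZl_EFin//; [|by move=> t _; rewrite lee_fin powR_ge0|exact: mwp|by rewrite mulr_ge0].
rewrite integral_cst// [X in (_ * X)%E]lebesgue_measure_itv /= lte_fin t12 -EFinB -EFinM.
apply: (@le_trans _ _ ((k * a * (t2 - t1))%:E + (k * a `^ (1 - p))%:E * A%:E)%E).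
  rewrite leeD2l// lee_wpmul2l ?lee_fin ?mulr_ge0//.
  apply: le_trans wA; apply: ge0_subset_integral => //.
  - exact: mwp.
  - by move=> t _; rewrite lee_fin powR_ge0.
  - move=> t; rewrite /I /= !in_itv /= => /andP[a1 a2]; apply/andP; split; lra.
rewrite -EFinM -EFinD lee_fin le_eqVlt; apply/orP; left; apply/eqP; ring.
Qed.

(** Reduction to [oscillation_real] by rotating [U t2 - U t1] onto the real axis. The second
    derivative [ddU] supplies the continuity of [dU]. *)
Lemma oscillation_curve (p a k A t1 t2 : R) (w : R -> R) (U dU ddU : R -> C) :
  1 < p -> 0 < a -> 0 <= k -> 0 <= t1 -> t1 <= t2 -> t2 <= 2 * pi ->
  continuous w -> (forall t, 0 <= w t) ->
  (\int[lebesgue_measure]_(t in `[0%R, (2 * pi)%R]) ((w t) `^ p)%:E <= A%:E)%E ->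
  (forall t, rder U t (dU t)) -> (forall t, rder dU t (ddU t)) ->
  (forall t, t1 <= t <= t2 -> cabs (dU t) <= k * w t) ->
  cabs (U t2 - U t1) <= k * (a * (t2 - t1) + a `^ (1 - p) * A).
Proof.
move=> p1 a0 k0 t10 t12 t2p cw w0 wA HU HdU Hw.
have [u u1 uE] := cabs_phase (U t2 - U t1).
have := @oscillation_real p a k A t1 t2 w (fun t => cre (u * U t)) (fun t => cre (u * dU t)).
rewrite -creB -mulrBr uE cre_ofR; apply=> //.
- by move=> t; apply: rder_cre; exact: has_derZ.
- by move=> t; apply: is_derive_continuous; apply: rder_cre; exact: has_derZ.
- by move=> t /Hw; apply: le_trans; apply: le_trans (cre_le _) _; rewrite cabsM u1 mul1r.
Qed.

End CircleCurve.

(** * Sufficiency *)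

Section HardyBounds.
Variable R : realType.
Local Notation C := (R[i])^o.
Implicit Types (f g : C -> C) (z w : C).

Lemma analytic_cder f z : analytic_on_disk f -> cabs z < 1 -> cder f z (cderiv f z).
Proof. by move=> h /h; exact: derivable_cder. Qed.

Lemma analytic_twice f : analytic_on_disk f -> analytic_on_disk (cderiv f) ->
  twice_der f (cderiv f) (cderiv (cderiv f)) 0 1.
Proof. by move=> h h1 z; rewrite subr0 => z1; split; exact: analytic_cder. Qed.

Lemma has_der_near f g z d : cabs z < 1 -> (forall w, cabs w < 1 -> f w = g w) ->
  cder f z d -> cder g z d.
Proof.
move=> z1 fg H e /H[k k0 K]; exists (Num.min k (1 - cabs z)).
  by rewrite lt_min k0; lra.
move=> h; rewrite lt_min => /andP[/K + hz]; rewrite !fg//.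
by apply: le_lt_trans (cabsD _ _) _; lra.
Qed.

Lemma circle_rder f f' (r t : R) : 0 <= r -> r < 1 ->
  (forall z, cabs z < 1 -> cder f z (f' z)) ->
  rder (fun s => f (ofR r * expi s)) t ('i%C * (ofR r * expi t) * f' (ofR r * expi t)).
Proof.
move=> r0 r1 H; apply: has_der_comp (rder_circle r t) (H _ _).
by rewrite cabs_circle.
Qed.

Lemma circle_continuous_cabs f (r : R) : 0 <= r -> r < 1 -> analytic_on_disk f ->
  continuous (fun s => cabs (f (ofR r * expi s))).
Proof.
move=> r0 r1 H t; apply: rder_continuous_cabs; apply: (circle_rder t r0 r1) => z.
exact: analytic_cder.
Qed.

Lemma pi2_gt0 : 0 < 2 * pi :> R.
Proof. by rewrite mulr_gt0// pi_gt0. Qed.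

Lemma Hp_normp_integral (p B r : R) g : 0 < r -> r < 1 ->
  (Hp_normp p g <= B%:E)%E ->
  (\int[lebesgue_measure]_(t in `[0%R, (2 * pi)%R])
     ((cabs (g (ofR r * expi t))) `^ p)%:E <= (B * (2 * pi))%:E)%E.
Proof.
move=> r0 r1 H; have : (integral_mean p g r <= B%:E)%E.
  apply: le_trans H; apply: ereal_sup_ubound; exists r => //.
  by rewrite /= in_itv /= r0.
rewrite /integral_mean lee_pdivrMr ?pi2_gt0//.
Qed.

Lemma Hp_normp_ge0 (p : R) g : (0 <= Hp_normp p g)%E.
Proof.
apply: (@le_trans _ _ (integral_mean p g 2^-1)).
  apply: mule_ge0; last by rewrite lee_fin invr_ge0 ltW// pi2_gt0.
  by apply: integral_ge0 => t _; rewrite lee_fin powR_ge0.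
by apply: ereal_sup_ubound; exists 2^-1 => //=; rewrite in_itv /=; lra.
Qed.

Lemma integral_meanE (p r : R) g : integral_mean p g r =
  (\int[lebesgue_measure]_(t in `[0%R, (2 * pi)%R])
     ((cabs (g (ofR r * expi t))) `^ p)%:E * ((2 * pi)^-1)%:E)%E.
Proof. by []. Qed.

Lemma Hp_normp_le (p K : R) f g : 0 < p -> 0 <= K ->
  analytic_on_disk f -> analytic_on_disk g ->
  (forall z, cabs z < 1 -> cabs (f z) <= K * cabs (g z)) ->
  (Hp_normp p f <= (K `^ p)%:E * Hp_normp p g)%E.
Proof.
move=> p0 K0 hf hg fg; apply: ge_ereal_sup => _ [r + <-].
rewrite /= in_itv /= => /andP[r0 r1].
have mI : measurable (`[0%R, (2 * pi)%R]%classic : set R) by exact: measurable_itv.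
have mp (h : C -> C) : analytic_on_disk h -> measurable_fun (`[0%R, (2 * pi)%R]%classic : set R)
    (EFin \o (fun t => cabs (h (ofR r * expi t)) `^ p)).
  by move=> hh; apply: measurable_EFin_powR; exact: circle_continuous_cabs (ltW r0) r1 hh.
apply: (@le_trans _ _ ((K `^ p)%:E * integral_mean p g r)%E); last first.
  apply: lee_wpmul2l; first by rewrite lee_fin powR_ge0.
  by apply: ereal_sup_ubound; exists r => //=; rewrite in_itv /= r0.
rewrite !integral_meanE muleA lee_pmul2r ?lte_fin ?invr_gt0 ?pi2_gt0//.
rewrite -ge0_integralZl_EFin ?powR_ge0//; last 2 first.
- by move=> t _; rewrite lee_fin powR_ge0.
- exact: (mp _ hg).
apply: ge0_le_integral => //.
- by move=> t _; rewrite lee_fin powR_ge0.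
- exact: (mp _ hf).
- by apply: measurable_funeM; exact: (mp _ hg).
- move=> t _; rewrite -EFinM lee_fin -powRM ?cabs_ge0//.
  apply: ge0_ler_powR; rewrite ?nnegrE ?mulr_ge0 ?cabs_ge0 ?(ltW p0)//.
  by apply: fg; rewrite cabs_circle// ltW.
Qed.

Lemma Hp_normp_cst1 (p : R) : (Hp_normp p (fun _ : C => (1%R : C)) <= 1%:E)%E.
Proof.
apply: ge_ereal_sup => _ [r _ <-]; rewrite /integral_mean lee_pdivrMr ?pi2_gt0//.
under eq_integral do rewrite cabs1 powR1.
rewrite integral_cst//.
rewrite !mul1e [leLHS]lebesgue_measure_itv /= lte_fin pi2_gt0.
by rewrite sube0.
Qed.

Lemma Hp_norm_le (p B : R) g : 0 < p -> 0 <= B ->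
  (Hp_normp p g <= (B `^ p)%:E)%E -> Hp_norm p g <= B.
Proof.
move=> p0 B0 H; rewrite /Hp_norm.
have F : Hp_normp p g \is a fin_num.
  by rewrite ge0_fin_numE ?Hp_normp_ge0//; apply: le_lt_trans H _; exact: ltry.
have L : fine (Hp_normp p g) <= B `^ p by rewrite -lee_fin fineK.
have pp : p * p^-1 = 1 by rewrite divff// gt_eqF.
rewrite -[leRHS](powRr1 B0) -pp powRrM.
apply: ge0_ler_powR; rewrite ?nnegrE ?powR_ge0 ?invr_ge0 ?(ltW p0)//.
by rewrite fine_ge0 ?Hp_normp_ge0.
Qed.

Lemma Hp_normpE (p : R) g : 0 < p -> (Hp_normp p g < +oo)%E ->
  Hp_normp p g = (Hp_norm p g `^ p)%:E.
Proof.
move=> p0 H; have F : Hp_normp p g \is a fin_num by rewrite ge0_fin_numE ?Hp_normp_ge0.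
rewrite /Hp_norm -powRrM mulVf ?gt_eqF// powRr1 ?fineK//.
by rewrite fine_ge0// Hp_normp_ge0.
Qed.

Lemma Hp_norm_ge0 (p : R) g : 0 <= Hp_norm p g.
Proof. exact: powR_ge0. Qed.

(* The oscillation bound controls [f - f r] on a circle, the maximum principle
   inside it, and the Cauchy estimates then control the derivatives. *)
Lemma Hp_derivative_bounds (p rho : R) : 1 < p -> 0 <= rho -> rho < 1 ->
  exists2 K : R, 0 <= K & forall f (H : R), 0 <= H -> analytic_on_disk f ->
    analytic_on_disk (cderiv f) -> (Hp_normp p (cderiv f) <= (H `^ p)%:E)%E ->
    forall z, cabs z <= rho ->
      cabs (cderiv f z) <= K * H /\ cabs (cderiv (cderiv f) z) <= K * H.
Proof.
move=> p1 rho0 rho1; have q0 := pi2_gt0.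
(* Disks of radius [s] about points of modulus at most [rho] stay within radius [r < 1], where [f]
   is compared with its value at one point of the circle. *)
pose r := (1 + rho) / 2; pose s := r - rho.
have s0 : 0 < s by rewrite /s /r; lra.
have [r0 r1] : 0 < r /\ r < 1 by rewrite /r; split; lra.
have K10 : 0 <= 4 * (2 * (2 * pi)) / s by rewrite divr_ge0 ?mulr_ge0 ?ltW//; lra.
have K20 : 0 <= 128 * (2 * (2 * pi)) / s ^+ 2 by rewrite divr_ge0 ?mulr_ge0 ?exprn_ge0 ?(ltW s0)//; lra.
exists (4 * (2 * (2 * pi)) / s + 128 * (2 * (2 * pi)) / s ^+ 2); first by rewrite addr_ge0.
move=> f H H0 hf hf1 HH z zr.
pose S := 2 * (2 * pi) * H.
have T := analytic_twice hf hf1.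
have circ (t : R) : 0 <= t -> t <= 2 * pi ->
    cabs (f (ofR r * expi t) - f (ofR r * expi 0)) <= S.
  move=> t0 t2; apply/ler_addgt0Pr => e e0.
  (* At [a = H] both terms of the oscillation bound are at most [2 * pi * H], whence [S]. The extra
     summand keeps [a] positive when [H = 0] and costs [e] in total. *)
  pose a := H + e / (2 * (2 * pi)).
  have ea : 0 < e / (2 * (2 * pi)) by rewrite divr_gt0//; lra.
  have a0 : 0 < a by rewrite /a; lra.
  have ader u : cder (fun z => 'i%C * z * cderiv f z) (ofR r * expi u)
      ('i%C * 1 * cderiv f (ofR r * expi u) + 'i%C * (ofR r * expi u) * cderiv (cderiv f) (ofR r * expi u)).
    apply: cderM; first by apply: has_derZ; exact: cder_id.
    by apply: analytic_cder => //; rewrite cabs_circle// ltW.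
  have := @oscillation_curve R p a 1 (H `^ p * (2 * pi)) 0 t
    (fun t => cabs (cderiv f (ofR r * expi t))) (fun t => f (ofR r * expi t))
    (fun t => 'i%C * (ofR r * expi t) * cderiv f (ofR r * expi t)) _
    p1 a0 ler01 (lexx _) t0 t2 (circle_continuous_cabs (ltW r0) r1 hf1)
    (fun _ => cabs_ge0 _) (Hp_normp_integral r0 r1 HH)
    (fun u => circle_rder u (ltW r0) r1 (fun z => analytic_cder hf))
    (fun u => has_der_comp (rder_circle r u) (ader u)) _.
  move=> B; apply: le_trans (B _) _.
    move=> u _; rewrite mul1r !cabsM cabs_i mul1r cabs_expi mulr1 cabs_ofR.
    by rewrite gtr0_norm// ler_piMl ?cabs_ge0// ltW.
  have aH : a `^ (1 - p) * H `^ p <= a.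
    apply: (@le_trans _ _ (a `^ (1 - p) * a `^ p)).
      rewrite ler_wpM2l ?powR_ge0//; apply: ge0_ler_powR; rewrite ?nnegrE /a; lra.
    by rewrite -powRD ?subrK ?powRr1 ?(ltW a0)//; apply/implyP => _; rewrite gt_eqF.
  have -> : S + e = 2 * (2 * pi) * a.
    by rewrite /S /a; field; apply/eqP; move: q0; lra.
  by rewrite mul1r subr0 mulrA; nra.
have S0 : 0 <= S by rewrite /S !mulr_ge0// ltW// pi_gt0.
pose g z := f z - f (ofR r * expi 0).
have Tg : twice_der g (cderiv f) (cderiv (cderiv f)) 0 1.
  move=> w /T[a b]; split; last exact: b.
  apply: has_der_eqd (has_derB a (has_der_cst id (f (ofR r * expi 0)) w)) _.
  by rewrite subr0.
have gS w : cabs (w - 0) <= r -> cabs (g w) <= S.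
  apply: (max_principle (r':=1)) => //; first lra.
    by exists (cderiv f), (cderiv (cderiv f)).
  move=> x; rewrite subr0 => xr.
  have [t /andP[t0 t2] ->] := polar_form x; rewrite xr; apply: circ => //; exact: ltW.
have gz w : cabs (w - z) < s -> cabs (g w) <= S.
  move=> wz; apply: gS; have -> : w - 0 = (w - z) + z by ring.
  by apply: le_trans (cabsD _ _) _; move: wz; rewrite /s; lra.
have Tz : twice_der g (cderiv f) (cderiv (cderiv f)) z s.
  by apply: twice_der_sub Tg; rewrite subr0 /s; lra.
have := cauchy_estimate s0 Tz gz; have := cauchy_estimate2 s0 Tz gz.
rewrite (mulrDl (4 * (2 * (2 * pi)) / s)).
have -> : 128 * S / s ^+ 2 = 128 * (2 * (2 * pi)) / s ^+ 2 * H.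
  by rewrite /S; field; rewrite gt_eqF.
have -> : 4 * S / s = 4 * (2 * (2 * pi)) / s * H.
  by rewrite /S; field; rewrite gt_eqF.
move=> A B; split.
  by apply: le_trans B _; rewrite lerDl mulr_ge0.
by apply: le_trans A _; rewrite lerDr mulr_ge0.
Qed.

Lemma sup_norm_disk_lt1 (phi : C -> C) : (sup_norm_disk phi < 1%:E)%E ->
  exists rho : R, [/\ 0 <= rho, rho < 1 & forall z, cabs z < 1 -> cabs (phi z) <= rho].
Proof.
move=> H; have ub z : cabs z < 1 -> ((cabs (phi z))%:E <= sup_norm_disk phi)%E.
  by move=> z1; apply: ereal_sup_ubound; exists z.
have c0 : cabs (0 : C) < 1 by rewrite cabs0.
have F : sup_norm_disk phi \is a fin_num.
  rewrite ge0_fin_numE; first exact: lt_trans H (ltry _).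
  by apply: le_trans (ub _ c0); rewrite lee_fin cabs_ge0.
exists (fine (sup_norm_disk phi)); split.
- by rewrite fine_ge0//; apply: le_trans (ub _ c0); rewrite lee_fin cabs_ge0.
- by rewrite -lte_fin fineK.
- by move=> z /ub; rewrite -{1}(fineK F) lee_fin.
Qed.

Lemma sum_bound (a b c d : R) : 0 <= a -> 0 <= b -> 0 <= c -> 0 <= d ->
  a * c + a * c * b <= a * (1 + b) * (d + c).
Proof.
move=> a0 b0 c0 d0; have : 0 <= a * (1 + b) * d by rewrite !mulr_ge0 ?addr_ge0.
lra.
Qed.

Lemma bounded_of_sup_norm (p : R) (phi : C -> C) : 1 < p ->
  self_map_disk phi -> in_Sp p phi ->
  (sup_norm_disk phi < 1%:E)%E -> Dcomp_bounded_Sp p phi.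
Proof.
move=> p1 phiD [phiA [phi1A phi1H]] /sup_norm_disk_lt1[rho [rho0 rho1 phirho]].
have p0 : 0 < p by lra.
have [K K0 HK] := Hp_derivative_bounds p1 rho0 rho1.
(* In the constant, [1] accounts for the value [f' (phi 0)] at 0 and the norm of [phi'] for the
   chain rule factor. *)
have main f : in_Sp p f ->
    in_Sp p (Dcomp phi f) /\
    Sp_norm p (Dcomp phi f) <= K * (1 + Hp_norm p (cderiv phi)) * Sp_norm p f.
  move=> [fA [f1A f1H]].
  have f1E := Hp_normpE p0 f1H.
  have f1le : (Hp_normp p (cderiv f) <= (Hp_norm p (cderiv f) `^ p)%:E)%E by rewrite f1E.
  have [H [H0 HE B]] : exists H, [/\ 0 <= H, Hp_norm p (cderiv f) = H &
      forall z, cabs z <= rho ->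
        cabs (cderiv f z) <= K * H /\ cabs (cderiv (cderiv f) z) <= K * H].
    exists (Hp_norm p (cderiv f)); split=> //; first exact: Hp_norm_ge0.
    exact: (HK f _ (Hp_norm_ge0 p (cderiv f)) fA f1A f1le).
  have SE : Sp_norm p f = cabs (f 0) + H by rewrite /Sp_norm HE.
  have T := analytic_twice fA f1A.
  pose v z := cderiv phi z * cderiv (cderiv f) (phi z).
  have uD z : cabs z < 1 -> cder (Dcomp phi f) z (v z).
    move=> z1; apply: has_der_comp (analytic_cder phiA z1) _.
    exact: analytic_cder f1A (phiD z z1).
  have uE z : cabs z < 1 -> v z = cderiv (Dcomp phi f) z.
    by move=> /uD/cder_cderiv.
  have uA : analytic_on_disk (Dcomp phi f) by move=> z /uD; exact: cder_derivable.
  have u1A : analytic_on_disk (cderiv (Dcomp phi f)).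
    (* Differentiating [(f'' o phi) phi'] once more takes a derivative of [f''] at [phi z]; the disk
       of radius [1 - cabs (phi z)] about [phi z] lies in the unit disk. *)
    move=> z z1; have [||d2 hd] := @second_derivative_cder R f (cderiv f) (cderiv (cderiv f)) (phi z) (1 - cabs (phi z)).
    - by have := phiD z z1; rewrite /disk /=; lra.
    - by apply: twice_der_sub T; rewrite subr0; lra.
    - apply: cder_derivable; apply: (has_der_near z1 uE).
      exact: cderM (analytic_cder phi1A z1) (has_der_comp (analytic_cder phiA z1) hd).
  have KH : 0 <= K * H by rewrite mulr_ge0.
  have uH : (Hp_normp p (cderiv (Dcomp phi f)) <=
      ((K * H * Hp_norm p (cderiv phi)) `^ p)%:E)%E.
    rewrite powRM ?Hp_norm_ge0// EFinM -Hp_normpE//.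
    apply: Hp_normp_le => // z z1; rewrite -uE// /v cabsM mulrC.
    by rewrite ler_wpM2r ?cabs_ge0//; case: (B (phi z)) => //; exact: phirho.
  split.
    split; first exact: uA.
    split; first exact: u1A.
    by apply: le_lt_trans uH _; exact: ltry.
  rewrite SE /Sp_norm; apply: (@le_trans _ _ (K * H + K * H * Hp_norm p (cderiv phi))).
    apply: lerD; last by apply: Hp_norm_le uH => //; rewrite mulr_ge0 ?Hp_norm_ge0.
    have phi0 : cabs (phi 0) <= rho by apply: phirho; rewrite cabs0.
    by have [B0 _] := B _ phi0; exact: B0.
  exact: (sum_bound K0 (Hp_norm_ge0 p (cderiv phi)) H0 (cabs_ge0 (f 0))).
split; first by move=> f /main[].
by exists (K * (1 + Hp_norm p (cderiv phi))) => f /main[].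
Qed.

End HardyBounds.

(** * Necessity *)

Section Necessity.
Variable R : realType.
Local Notation C := (R[i])^o.
Implicit Types (f g : C -> C) (z w : C).

(** Makes [oscillation_curve] uniform over an arc, with the two points in either order. *)
Lemma oscillation_arc (p a k A t1 t2 s t : R) (w : R -> R) (U dU ddU : R -> C) :
  1 < p -> 0 < a -> 0 <= k -> 0 <= A -> 0 <= t1 -> t2 <= 2 * pi ->
  t1 <= s <= t2 -> t1 <= t <= t2 ->
  continuous w -> (forall t, 0 <= w t) ->
  (\int[lebesgue_measure]_(t in `[0%R, (2 * pi)%R]) ((w t) `^ p)%:E <= A%:E)%E ->
  (forall t, rder U t (dU t)) -> (forall t, rder dU t (ddU t)) ->
  (forall t, t1 <= t <= t2 -> cabs (dU t) <= k * w t) ->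
  cabs (U t - U s) <= k * (a * (t2 - t1) + a `^ (1 - p) * A).
Proof.
move=> p1 a0 k0 A0 t10 t2p /andP[s1 s2] /andP[u1 u2] cw w0 wA HU HdU Hw.
have le_arc x : x <= t2 - t1 ->
    k * (a * x + a `^ (1 - p) * A) <= k * (a * (t2 - t1) + a `^ (1 - p) * A).
  by move=> xt; rewrite ler_wpM2l// lerD2r ler_wpM2l// ltW.
have [st|ts] := leP s t.
  apply: le_trans (le_arc (t - s) _); last lra.
  apply: (oscillation_curve (w:=w) p1 a0 k0 _ st _ cw w0 wA HU HdU); [lra|lra|].
  by move=> x /andP[x1 x2]; apply: Hw; apply/andP; split; lra.
rewrite cabsC; apply: le_trans (le_arc (s - t) _); last lra.
apply: (oscillation_curve (w:=w) p1 a0 k0 _ (ltW ts) _ cw w0 wA HU HdU); [lra|lra|].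
by move=> x /andP[x1 x2]; apply: Hw; apply/andP; split; lra.
Qed.

Lemma cderiv_monomial (n : nat) :
  cderiv (fun z : C => (n.+1%:R)^-1 * z ^+ n.+1) = (fun z => z ^+ n).
Proof.
apply/funext => z; apply: cder_cderiv.
apply: has_der_eqd (has_derZ _ (cderX n.+1 (cder_id z))) _.
by rewrite /= mulr1 mulKf// pnatr_eq0.
Qed.

(** The test functions: normalized primitives of [z ^+ n] vanishing at 0, which the operator sends
    to the powers of [phi]. *)
Lemma monomial_in_Sp (p : R) (n : nat) : 1 < p ->
  in_Sp p (fun z : C => (n.+1%:R)^-1 * z ^+ n.+1) /\
  Sp_norm p (fun z : C => (n.+1%:R)^-1 * z ^+ n.+1) <= 1.
Proof.
move=> p1; have p0 : 0 < p by lra.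
have A1 : analytic_on_disk (fun z : C => z ^+ n).
  by move=> z _; apply: cder_derivable; apply: cderX; exact: cder_id.
have Hle : (Hp_normp p (fun z : C => (z ^+ n)%R) <= 1%:E)%E.
  apply: (@le_trans _ _ ((1 `^ p)%:E * Hp_normp p (fun _ : C => (1%R : C)))%E).
    have A0 : analytic_on_disk (fun _ : C => (1%R : C)) by move=> z _; exact: derivable_cst.
    apply: (Hp_normp_le p0 ler01 A1 A0) => z z1.
    by rewrite cabs1 mulr1 cabsX exprn_ile1 ?cabs_ge0//; exact: ltW.
  by rewrite powR1 mul1e; exact: Hp_normp_cst1.
split.
  split; first by move=> z _; apply: cder_derivable; apply: has_derZ; apply: cderX; exact: cder_id.
  rewrite cderiv_monomial; split; first exact: A1.
  by apply: le_lt_trans Hle _; exact: ltry.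
rewrite /Sp_norm cderiv_monomial exprS mul0r mulr0 cabs0 add0r.
by apply: Hp_norm_le => //; rewrite powR1.
Qed.

Lemma power_Hp_bound (p : R) (phi : C -> C) : 1 < p -> Dcomp_bounded_Sp p phi ->
  exists2 B : R, 0 <= B & forall n : nat,
    in_Sp p (fun z => phi z ^+ n) /\
    (Hp_normp p (cderiv (fun z => (phi z ^+ n)%R)) <= B%:E)%E.
Proof.
move=> p1 [HS [M HM]]; have p0 : 0 < p by lra.
(* [Hp_normp] is the [p]-th power of the norm, and the sign of [M] is unknown. *)
exists (`|M| `^ p); first exact: powR_ge0.
move=> n; have [mS mN] := @monomial_in_Sp p n p1.
have := HS _ mS; have := HM _ mS.
have -> : Dcomp phi (fun z : C => (n.+1%:R)^-1 * z ^+ n.+1) = (fun z => phi z ^+ n).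
  by rewrite /Dcomp cderiv_monomial.
move=> B iS; split; [exact: iS|]; have [_ [_ fin]] := iS.
rewrite (Hp_normpE p0 fin) lee_fin.
apply: ge0_ler_powR; rewrite ?nnegrE ?Hp_norm_ge0 ?normr_ge0 ?(ltW p0)//.
apply: le_trans (le_trans _ B) _; first by rewrite /Sp_norm lerDr cabs_ge0.
have S0 : 0 <= Sp_norm p (fun z : C => (n.+1%:R)^-1 * z ^+ n.+1).
  by rewrite /Sp_norm addr_ge0 ?cabs_ge0 ?Hp_norm_ge0.
apply: (@le_trans _ _ (`|M| * Sp_norm p (fun z : C => (n.+1%:R)^-1 * z ^+ n.+1))).
  by rewrite ler_wpM2r// ler_norm.
by rewrite ler_piMr.
Qed.

(** As [1 - p < 0], a large [a] works: the witness solves [a ^ (p - 1) = A / e + 1], where [+ 1]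
    covers [A = 0]. *)
Lemma powR_neg_small (p A e : R) : 1 < p -> 0 <= A -> 0 < e ->
  exists2 a : R, 0 < a & a `^ (1 - p) * A <= e.
Proof.
move=> p1 A0 e0; have q0 : 0 < A / e + 1.
  have : 0 <= A / e by rewrite divr_ge0// ltW.
  lra.
exists ((A / e + 1) `^ ((p - 1)^-1)); first exact: powR_gt0.
rewrite -powRrM.
have -> : (p - 1)^-1 * (1 - p) = -1 by field; apply/eqP; lra.
rewrite powRN powRr1 ?(ltW q0)// ler_pdivrMl// mulrDl divfK ?gt_eqF//.
lra.
Qed.

(** Differences of values of [phi] are at most 2, so one rotation landing on the good arc makes the
    whole product small. *)
Lemma prod_small (n : nat) (x : 'I_n -> R) (e : R) (j : 'I_n) :
  (forall i, 0 <= x i <= 2) -> x j <= e -> \prod_i x i <= e * 2 ^+ n.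
Proof.
move=> x2 xj; have e0 : 0 <= e by apply: le_trans xj; case/andP: (x2 j).
rewrite (bigD1 j)//=; apply: ler_pM => //; first by case/andP: (x2 j).
  by apply: prodr_ge0 => i _; case/andP: (x2 i).
apply: le_trans (_ : \prod_(i < n | i != j) 2 <= _).
  by apply: ler_prod => i _; exact: x2.
rewrite prodr_const ler_weXn2l ?ler1n//.
by apply: leq_trans (max_card _) _; rewrite card_ord.
Qed.

(** If [t] lies in the arc of index [m], rotating by [k + N - m] steps brings it to the arc of index
    [k]. The summand [N] is a full turn that keeps the subtraction natural, hence [N + N]
    rotations. *)
Lemma rotate_to_arc (N k : nat) (t : R) : (0 < N)%N -> (k < N)%N ->
  0 <= t < 2 * pi -> exists (j : 'I_(N + N)) (s : R),
    2 * pi * k%:R / N%:R <= s <= 2 * pi * k.+1%:R / N%:R /\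
    expi (2 * pi * j%:R / N%:R) * expi t = expi s.
Proof.
move=> N0 kN /andP[t0 t2]; have q0 := @pi2_gt0 R.
have NR : 0 < N%:R :> R by rewrite ltr0n.
have y0 : 0 <= t * N%:R / (2 * pi) by apply: divr_ge0; rewrite ?(ltW q0)// mulr_ge0.
set m := Num.truncn (t * N%:R / (2 * pi)).
have /andP[m1 m2] := truncn_itv y0; rewrite -/m in m1 m2.
have mN : (m < N)%N.
  rewrite -(ltr_nat R); apply: le_lt_trans m1 _.
  by rewrite ltr_pdivrMr// mulrC ltr_pM2l.
have jN : (k + N - m < N + N)%N.
  by apply: leq_ltn_trans (leq_subr _ _) _; rewrite ltn_add2r.
exists (Ordinal jN).
have mle : (m <= k + N)%N by apply: leq_trans (ltnW mN) (leq_addl _ _).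
move: m1 m2; rewrite ler_pdivlMr// ltr_pdivrMr// => m1 m2.
exists (t - 2 * pi * m%:R / N%:R + 2 * pi * k%:R / N%:R); split.
  apply/andP; split; first by rewrite lerDr subr_ge0 ler_pdivrMr// mulrC.
  have step (l : nat) : 2 * pi * l.+1%:R / N%:R = 2 * pi * l%:R / N%:R + 2 * pi / N%:R :> R.
    by rewrite -natr1; ring.
  have : t <= 2 * pi * m.+1%:R / N%:R by rewrite ler_pdivlMr// (mulrC (2 * pi)) ltW.
  by rewrite !step; lra.
rewrite -expiD -[in RHS]expi_period /= natrB// natrD; congr expi.
by field; rewrite gt_eqF.
Qed.

Lemma sup_norm_disk_lt1_of (phi : C -> C) (eta : R) : eta < 1 ->
  (forall z, cabs z < 1 -> cabs (phi z) <= eta) -> (sup_norm_disk phi < 1%:E)%E.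
Proof.
move=> e1 H; apply: (@le_lt_trans _ _ eta%:E); last by rewrite lte_fin.
by apply: ge_ereal_sup => _ [z z1 <-]; rewrite lee_fin; exact: H.
Qed.

(* On an arc through a point where [|phi|^n >= 1/2], the function [phi^n] has
   oscillation at most 1/4, so [|phi|^n >= 1/4] there and
   [|phi'| <= (4/n) |(phi^n)'|]. *)
Lemma arc_oscillation (p a A r t1 t2 t0 s : R) (phi : C -> C) (n : nat) :
  1 < p -> 0 < a -> 0 <= A -> 0 < r -> r < 1 ->
  analytic_on_disk phi -> self_map_disk phi -> analytic_on_disk (cderiv phi) ->
  in_Sp p (fun z => phi z ^+ n.+1) ->
  (Hp_normp p (cderiv (fun z => (phi z ^+ n.+1)%R)) <= A%:E)%E ->
  0 <= t1 -> t2 <= 2 * pi -> t1 <= t0 <= t2 -> t1 <= s <= t2 ->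
  a * (t2 - t1) + a `^ (1 - p) * (A * (2 * pi)) <= 4^-1 ->
  2^-1 <= cabs (phi (ofR r * expi t0)) ^+ n.+1 ->
  cabs (phi (ofR r * expi s) - phi (ofR r * expi t0)) <= n.+1%:R^-1.
Proof.
move=> p1 a0 A0 r0 r1 phA phD ph1A [uA [u1A _]] uH t10 t2p t0I sI small big.
have q0 := @pi2_gt0 R.
pose u z := phi z ^+ n.+1.
have cder_circ f t : analytic_on_disk f -> cder (fun z => 'i%C * z * f z) (ofR r * expi t)
    ('i%C * 1 * f (ofR r * expi t) + 'i%C * (ofR r * expi t) * cderiv f (ofR r * expi t)).
  move=> fA; apply: cderM; first by apply: has_derZ; exact: cder_id.
  by apply: analytic_cder => //; rewrite cabs_circle// ltW.
have norm_circ f t : cabs ('i%C * (ofR r * expi t) * f (ofR r * expi t)) <=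
    cabs (f (ofR r * expi t)).
  rewrite !cabsM cabs_i mul1r cabs_expi mulr1 cabs_ofR.
  by rewrite gtr0_norm// ler_piMl ?cabs_ge0// ltW.
have A20 : 0 <= A * (2 * pi) by rewrite mulr_ge0// ltW.
have int_u := Hp_normp_integral r0 r1 uH.
have cw := circle_continuous_cabs (ltW r0) r1 u1A.
have w0 (t : R) : 0 <= cabs (cderiv u (ofR r * expi t)) by exact: cabs_ge0.
(* Used first for [u] with [k = 1], which gives [low], then for [phi] with [k = 4 * n.+1%:R^-1],
   where [low] compares the derivatives. *)
have osc f (k x : R) : analytic_on_disk f -> analytic_on_disk (cderiv f) ->
    0 <= k -> t1 <= x <= t2 ->
    (forall t : R, t1 <= t <= t2 -> cabs (cderiv f (ofR r * expi t)) <=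
       k * cabs (cderiv u (ofR r * expi t))) ->
    cabs (f (ofR r * expi x) - f (ofR r * expi t0)) <= k * 4^-1.
  move=> fA f1A k0 xI fu.
  have := @oscillation_arc p a k (A * (2 * pi)) t1 t2 t0 x
    (fun t => cabs (cderiv u (ofR r * expi t))) (fun t => f (ofR r * expi t))
    (fun t => 'i%C * (ofR r * expi t) * cderiv f (ofR r * expi t)) _
    p1 a0 k0 A20 t10 t2p t0I xI cw w0 int_u
    (fun u => circle_rder u (ltW r0) r1 (fun z => analytic_cder fA))
    (fun t => has_der_comp (rder_circle r t) (cder_circ _ t f1A)) _.
  move=> B; apply: le_trans (B _) _; last by rewrite ler_wpM2l.
  by move=> t tI; apply: le_trans (norm_circ _ _) _; exact: fu.
have low (t : R) : t1 <= t <= t2 -> 4^-1 <= cabs (phi (ofR r * expi t)) ^+ n.+1.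
  move=> tI; have B : cabs (u (ofR r * expi t) - u (ofR r * expi t0)) <= 1 * 4^-1.
    by apply: (osc u 1 t uA u1A ler01 tI) => x _; rewrite mul1r.
  have := cabs_leB (u (ofR r * expi t0)) (u (ofR r * expi t)).
  rewrite (cabsC (u (ofR r * expi t0))) /u !cabsX => D.
  by move: B; rewrite mul1r /u; lra.
have n0 : 0 < n.+1%:R :> R by rewrite ltr0n.
have := osc phi (4 * n.+1%:R^-1) s phA ph1A _ sI _.
have -> : 4 * n.+1%:R^-1 * 4^-1 = n.+1%:R^-1 :> R.
  by rewrite mulrAC divff ?mul1r// pnatr_eq0.
apply; first by rewrite mulr_ge0 ?invr_ge0 ?ltW.
move=> t tI.
have x1 : cabs (ofR r * expi t) < 1 by rewrite cabs_circle// ltW.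
have ph1 := phD _ x1; rewrite /disk /= in ph1.
rewrite (cder_cderiv (cderX n.+1 (analytic_cder phA x1))) /=.
rewrite !cabsM cabsX -ofR_nat cabs_ofR ger0_norm ?(ltW n0)//.
have -> : 4 * n.+1%:R^-1 * (n.+1%:R * cabs (phi (ofR r * expi t)) ^+ n *
    cabs (cderiv phi (ofR r * expi t))) =
   4 * cabs (phi (ofR r * expi t)) ^+ n * cabs (cderiv phi (ofR r * expi t)).
  by rewrite -!mulrA mulKf// gt_eqF.
rewrite ler_peMl ?cabs_ge0//.
(* Since [phi] has modulus below 1, the lower bound for the power [n.+1] passes to the power [n] in
   the derivative. *)
have := low t tI; rewrite exprS => L.
have P0 := cabs_ge0 (phi (ofR r * expi t)).
have E0 : 0 <= cabs (phi (ofR r * expi t)) ^+ n by rewrite exprn_ge0.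
nra.
Qed.

Lemma sup_norm_of_bounded (p : R) (phi : C -> C) : 1 < p ->
  self_map_disk phi -> in_Sp p phi ->
  Dcomp_bounded_Sp p phi -> (sup_norm_disk phi < 1%:E)%E.
Proof.
move=> p1 phD [phA [ph1A _]] /(power_Hp_bound p1)[A A0 HA].
have q0 := @pi2_gt0 R.
have c0 : cabs (0 : C) < 1 by rewrite cabs0.
pose b := cabs (phi 0).
have b1 : b < 1 := phD _ c0.
have b0 : 0 <= b := cabs_ge0 _.
have A20 : 0 <= A * (2 * pi) by rewrite mulr_ge0// ltW.
(* The allowance [4^-1] of [arc_oscillation] is split in two: a large [a] makes the integral term at
   most [8^-1], then a large [N] does the same for the length term. *)
have [a a0 aA] := @powR_neg_small p (A * (2 * pi)) 8^-1 p1 A20 ltac:(lra).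
have [N' NE] := archi_gt (8 * a * (2 * pi)).
pose N := N'.+1.
have NR : 0 < N%:R :> R by rewrite ltr0n.
have Nbig : 8 * a * (2 * pi) < N%:R by apply: lt_le_trans NE _; rewrite ler_nat.
pose q := (1 - b) / 2.
have qp : 0 < q by rewrite /q; lra.
(* For this [n] the upper bound [2 ^+ (N + N) / n.+1] for the product at 0 falls below
   [q ^+ (N + N)]. *)
have [n nE] := archi_gt (2 ^+ (N + N) / q ^+ (N + N)).
have {}nE : 2 ^+ (N + N) / q ^+ (N + N) < n.+1%:R by apply: lt_trans nE _; rewrite ltr_nat.
have n0 : 0 < n.+1%:R :> R by rewrite ltr0n.
(* By Bernoulli's inequality [(1 - v) ^+ n.+1] is at least [2^-1]. *)
have [v [v0 v1 vE]] : exists v : R, [/\ 0 < v, v <= 1 & n.+1%:R * v = 2^-1].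
  exists (2^-1 / n.+1%:R); split; first by rewrite divr_gt0// invr_gt0.
    by rewrite ler_pdivrMr// mul1r; have : 1 <= n.+1%:R :> R by [rewrite ler1n]; lra.
  by rewrite mulrC divfK// gt_eqF.
(* Above the first entry, [phi z] is farther than [q] from [phi 0]; above the second, its power
   [n.+1] has modulus at least [2^-1]. *)
pose eta := Num.max ((1 + b) / 2) (1 - v).
apply: (@sup_norm_disk_lt1_of _ eta); first by rewrite /eta gt_max; apply/andP; split; lra.
move=> z z1; rewrite leNgt; apply/negP; rewrite /eta gt_max => /andP[e1 e2].
have ph2 : 2^-1 <= cabs (phi z) ^+ n.+1.
  apply: (@le_trans _ _ ((1 - v) ^+ n.+1)); last first.
    by rewrite lerXn2r ?nnegrE ?cabs_ge0 ?(ltW e2)//; lra.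
  have := @bernoulli R (- v) n.+1; rewrite mulrN vE => B.
  apply: le_trans (B _); lra.
pose r := cabs z.
have r0 : 0 < r.
  rewrite /r lt_def cabs_ge0 andbT cabs_eq0; apply: contraTneq e1 => ->.
  by rewrite -leNgt -/b; lra.
have [t0 /andP[t00 t02] zE] := polar_form z.
have y0 : 0 <= t0 * N%:R / (2 * pi) by apply: divr_ge0; rewrite ?(ltW q0)// mulr_ge0.
pose k := Num.truncn (t0 * N%:R / (2 * pi)).
have /andP[k1 k2] := truncn_itv y0; rewrite -/k in k1 k2.
have kN : (k < N)%N.
  rewrite -(ltr_nat R); apply: le_lt_trans k1 _.
  by rewrite ltr_pdivrMr// mulrC ltr_pM2l.
pose t1 : R := 2 * pi * k%:R / N%:R; pose t2 : R := 2 * pi * k.+1%:R / N%:R.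
have t10 : 0 <= t1 by apply: divr_ge0 => //; apply: mulr_ge0 => //; exact: ltW.
have t2p : t2 <= 2 * pi by rewrite ler_pdivrMr// ler_pM2l// ler_nat.
have tI : t1 <= t0 <= t2.
  move: k1 k2; rewrite ler_pdivlMr// ltr_pdivrMr// => k1 k2.
  by rewrite ler_pdivrMr// ler_pdivlMr// (mulrC (2 * pi)) k1 (mulrC (2 * pi)) ltW.
have small : a * (t2 - t1) + a `^ (1 - p) * (A * (2 * pi)) <= 4^-1.
  have : a * (t2 - t1) <= 8^-1.
    have -> : a * (t2 - t1) = a * (2 * pi) / N%:R.
      by rewrite /t1 /t2 -[k.+1]addn1 natrD; field; rewrite gt_eqF.
    by rewrite ler_pdivrMr//; lra.
  lra.
have [uS uH] := HA n.+1.
rewrite {1}zE in ph2.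
have arc s : t1 <= s <= t2 -> cabs (phi (ofR r * expi s) - phi z) <= n.+1%:R^-1.
  move=> sI; rewrite [in phi z]zE.
  exact: (arc_oscillation p1 a0 A0 r0 z1 phA phD ph1A uS uH t10 t2p tI sI small ph2).
(* All factors take the value [phi 0 - phi z] at 0, and at each point of the circle through [z] one
   of them is at most [n.+1%:R^-1]. The [+ 0] fits [twice_cder_affine]. *)
pose F (j : 'I_(N + N)) (x : C) := phi (expi (2 * pi * j%:R / N%:R) * x + 0) - phi z.
pose G x := \prod_(j <- index_enum 'I_(N + N)) F j x.
have G2 : twice_cder G 0 1.
  apply: twice_cder_prod => j.
  have [|g1 [g2 D]] := @twice_cder_affine R phi 0 1 (expi (2 * pi * j%:R / N%:R)) 0 (cabs_expi _).
    by rewrite mulr0 addr0; exists (cderiv phi), (cderiv (cderiv phi)); exact: analytic_twice.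
  exists g1, g2 => x /D[d1 d2]; split; last exact: d2.
  by apply: has_der_eqd (has_derB d1 (has_der_cst id (phi z) x)) _; rewrite subr0.
have circ x : cabs (x - 0) = r -> cabs (G x) <= n.+1%:R^-1 * 2 ^+ (N + N).
  rewrite subr0 => xr; have [t tJ xE] := polar_form x.
  have [j [s [sI sE]]] := rotate_to_arc (isT : (0 < N)%N) kN tJ.
  rewrite /G cabs_prod; apply: (@prod_small _ _ _ j).
    move=> i; rewrite cabs_ge0 /=; apply: le_trans (cabsB _ _) _.
    have : cabs (phi z) < 1 := phD _ z1.
    have : cabs (phi (expi (2 * pi * i%:R / N%:R) * x + 0)) < 1.
      by apply: phD; rewrite /disk /= addr0 cabsM cabs_expi mul1r xr.
    lra.
  by rewrite /F addr0 xE xr mulrCA sE; exact: arc.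
have P0 : 0 <= n.+1%:R^-1 * 2 ^+ (N + N) :> R by rewrite mulr_ge0 ?invr_ge0 ?exprn_ge0 ?ltW.
have := max_principle (cabs_ge0 z) z1 P0 G2 circ (z:=0).
rewrite subrr cabs0 => /(_ (cabs_ge0 z)).
rewrite /G cabs_prod.
under eq_bigr do rewrite /F mulr0 addr0.
rewrite prodr_const card_ord leNgt => /negP; apply.
rewrite mulrC ltr_pdivrMr//.
apply: (@lt_le_trans _ _ (q ^+ (N + N) * n.+1%:R)).
  by rewrite mulrC -ltr_pdivrMr// exprn_gt0.
rewrite ler_wpM2r ?(ltW n0)// lerXn2r ?nnegrE ?cabs_ge0 ?(ltW qp)//.
have := cabs_leB (phi z) (phi 0); rewrite (cabsC (phi z)) -/b /q; lra.
Qed.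

End Necessity.

Theorem theorem3p3 (R : realType) (p : R) (phi : (R[i])^o -> (R[i])^o) :
  1 < p ->
  analytic_on_disk phi -> self_map_disk phi -> in_Sp p phi ->
  (Dcomp_bounded_Sp p phi <-> (sup_norm_disk phi < 1%:E)%E).
Proof.
move=> p1 _ phiD phiS; split.
  exact: sup_norm_of_bounded.
exact: bounded_of_sup_norm.
Qed.
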